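(* Let $G$ be an $n$-vertex PLB graph with parameters $2<\alpha<7/3$ and $t$, and assume $G$ has PLB neighborhoods. Then algorithm CountTrianglesFMM with $\delta=n^{(\omega-1)/(7-\omega+(\omega-3)\alpha)}(t+1)^{1-2/(7-\omega+(\omega-3)\alpha)}$ computes the number of triangles in $G$ in $O\big(n^{(23.04-7.68\alpha)/(7.46-\alpha)}(t+1)^{7.67(\alpha-1)/(7.46-\alpha)}\big)$ time.
   Context: Graphs are finite, simple, undirected; $n$ is the number of vertices; $\log$ is binary. Fix universal constants $c_1,c_2>0$. An $n$-vertex graph $G$ is power law bounded (PLB) with parameters $\alpha$ and $t$ ($\alpha>1$ a constant, $t\ge0$ real) if for every integer $d\ge0$ the number of vertices $v$ with $\deg(v)\in[2^d,2^{d+1})$ is at most $c_1n(t+1)^{\alpha-1}\sum_{i=2^d}^{2^{d+1}-1}(i+t)^{-\alpha}$. A PLB graph with parameters $\alpha>2$ and $t$ has PLB neighborhoods if for every vertex $v$ of degree $k$, the number of neighbors of $v$ of degree at least $k$ is at most $c_2\max(\log n,(t+1)^{\alpha-2}k\sum_{i=k}^{n-1}i(i+t)^{-\alpha})$. $O(\cdot)$ hides constants depending only on $c_1,c_2,\alpha$. $\omega$ is the exponent of square matrix multiplication; numerical exponents are obtained using $\omega=2.38$. Let $\vec G$ be obtained by sorting vertices in non-decreasing order of degree and orienting each edge towards its later endpoint. Algorithm CountTrianglesFMM($G,\delta$): build $\vec G$; set a counter to $0$; for each vertex $v$, let $S$ be the out-neighbor set of $v$ in $\vec G$; for each in-edge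 $wv$ of $v$ with $\deg_G(w)\le\delta$ and each out-edge $wu$ of $w$ in $\vec G$, if $u\in S$ increment the counter. Then let $G_\delta$ be the subgraph induced on vertices of degree more than $\delta$ and return the counter plus the number of triangles in $G_\delta$ counted using fast matrix multiplication.
   Formalization: The printed exponents, rounded slightly too small (edgeless graphs, t=0, α=2.333 violate the bound), are replaced by the exact 2ω(3-α)/D of n and 2ω(α-1)/D of t+1, D=7-ω+(ω-3)α, for any ω≥2 with O(N^ω) multiplication; at ω=2.38 they are within 0.01 of those printed; n≥1. *)

(* Defs.v *)
From HB Require Import structures.
From mathcomp Require Import all_boot all_order all_algebra.
From mathcomp Require Import all_classical all_reals all_analysis.

Set Implicit Arguments.
Unset Strict Implicit.
Unset Printing Implicit Defensive.

Import Order.TTheory GRing.Theory Num.Theory.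

(** * Graphs *)

(* An n-vertex graph is an adjacency relation on 'I_n. *)
Definition simple_graph (n : nat) (e : rel 'I_n) : Prop :=
  symmetric e /\ irreflexive e.

Definition deg (n : nat) (e : rel 'I_n) (v : 'I_n) : nat :=
  #|[set w : 'I_n | e v w]|.

Definition triangles (n : nat) (e : rel 'I_n) : nat :=
  #|[set T : {set 'I_n} | (#|T| == 3) &&
       [forall u in T, forall v in T, (u != v) ==> e u v]]|.

Section PLB.
Local Open Scope ring_scope.
Context {R : realType}.

Definition log2 (x : R) : R := ln x / ln 2.

Definition PLB (c1 : R) (n : nat) (e : rel 'I_n) (alpha t : R) : Prop :=
  [/\ 1 < alpha, 0 <= t &
   forall d : nat,
     #|[set v : 'I_n | (2 ^ d <= deg e v < 2 ^ d.+1)%N]|%:R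
       <= c1 * n%:R * (t + 1) `^ (alpha - 1)
          * \sum_(2 ^ d <= i < 2 ^ d.+1) (i%:R + t) `^ (- alpha)].

Definition PLB_neighborhoods (c2 : R) (n : nat) (e : rel 'I_n) (alpha t : R)
    : Prop :=
  forall v : 'I_n,
    #|[set w : 'I_n | e v w && (deg e v <= deg e w)%N]|%:R
      <= c2 * Num.max (log2 n%:R)
           ((t + 1) `^ (alpha - 2) * (deg e v)%:R
            * \sum_(deg e v <= i < n) i%:R * (i%:R + t) `^ (- alpha)).

(* The common denominator of the exponents. *)
Definition expden (omega alpha : R) : R := 7 - omega + (omega - 3) * alpha.

Definition delta (omega alpha : R) (n : nat) (t : R) : R :=
  n%:R `^ ((omega - 1) / expden omega alpha)
  * (t + 1) `^ (1 - 2 / expden omega alpha).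

(* Exponents of n and t + 1 in the running time.  At omega = 2.38, dividing
   numerator and denominator by 3 - omega = 0.62 gives
   (23.032.. - 7.677.. alpha) / (7.451.. - alpha)  and
   7.677.. (alpha - 1) / (7.451.. - alpha). *)
Definition time_exp_n (omega alpha : R) : R :=
  (6 * omega - 2 * omega * alpha) / expden omega alpha.

Definition time_exp_t (omega alpha : R) : R :=
  2 * omega * (alpha - 1) / expden omega alpha.

End PLB.

(** * A unit-cost random access machine *)

Inductive var :=
  (* inputs: number of vertices, degree threshold; output: the counter *)
  | nv | thr | cnt
  (* work registers *)
  | xd | xu | xv | xw | xi | xj | xk | xN | xtot.

Inductive arr :=
  (* input: degrees and adjacency lists *)
  | DEG | ADJ
  (* the sort, and the oriented graph: out- and in-lists with their lengths *)
  | START | POS | OUT | OUTDEG | IN | INDEG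
  (* characteristic vector of S *)
  | MARK
  (* numbering of the vertices of G_delta, its adjacency matrix, a product *)
  | IDX | HIGH | MA | MB.

Scheme Equality for var.
Scheme Equality for arr.

Inductive expr :=
  | ELit of nat
  | EVar of var
  | EGet of arr & expr & expr
  | EAdd of expr & expr
  | EDiv of expr & expr
  | ELe of expr & expr
  | ELt of expr & expr.

Inductive cmd :=
  | CSkip
  | CSet of var & expr
  | CPut of arr & expr & expr & expr
  | CSeq of cmd & cmd
  | CIf of expr & cmd & cmd
  | CFor of var & expr & expr & cmd
  (* [CMatMul c a b e]: the e x e matrix stored in c becomes the product of
     those stored in a and b *)
  | CMatMul of arr & arr & arr & expr.

Record store := Store {
  reg : var -> nat;
  cell : arr -> nat -> nat -> nat }.

Definition set_reg (s : store) (x : var) (m : nat) : store :=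
  Store (fun y => if var_beq x y then m else reg s y) (cell s).

Definition set_mem (s : store) (a : arr) (p q m : nat) : store :=
  Store (reg s) (fun b p' q' =>
    if [&& arr_beq a b, p' == p & q' == q] then m else cell s b p' q').

Definition set_product (s : store) (c a b : arr) (m : nat) : store :=
  Store (reg s) (fun x p q =>
    if [&& arr_beq c x, p < m & q < m]
    then \sum_(r < m) cell s a p r * cell s b r q else cell s x p q).

Fixpoint eval (s : store) (e : expr) : nat :=
  match e with
  | ELit m => m
  | EVar x => reg s x
  | EGet a e1 e2 => cell s a (eval s e1) (eval s e2)
  | EAdd e1 e2 => eval s e1 + eval s e2
  | EDiv e1 e2 => eval s e1 %/ eval s e2
  | ELe e1 e2 => (eval s e1 <= eval s e2) : nat
  | ELt e1 e2 => (eval s e1 < eval s e2) : nat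
  end.

Fixpoint ecost (e : expr) : nat :=
  match e with
  | ELit _ | EVar _ => 1
  | EGet _ e1 e2 | EAdd e1 e2 | EDiv e1 e2 | ELe e1 e2
  | ELt e1 e2 => (ecost e1 + ecost e2).+1
  end.

(* Every node of a command or expression takes one step each time it is
   executed, and so does every loop iteration; uninitialized memory may hold
   anything.  [exec mm c s] is the final store together with the number of steps, where
   multiplying two m x m matrices takes [mm m] steps. *)
Fixpoint exec (mm : nat -> nat) (c : cmd) (s : store) : store * nat :=
  match c with
  | CSkip => (s, 1)
  | CSet x e => (set_reg s x (eval s e), (ecost e).+1)
  | CPut a e1 e2 e =>
      (set_mem s a (eval s e1) (eval s e2) (eval s e),
       (ecost e1 + ecost e2 + ecost e).+1)
  | CSeq c1 c2 =>
      let r1 := exec mm c1 s in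
      let r2 := exec mm c2 r1.1 in
      (r2.1, r1.2 + r2.2)
  | CIf e c1 c2 =>
      let r := exec mm (if eval s e == 0 then c2 else c1) s in
      (r.1, (ecost e + r.2).+1)
  | CFor x e1 e2 c1 =>
      foldl (fun r m =>
               let r' := exec mm c1 (set_reg r.1 x m) in
               (r'.1, (r.2 + r'.2).+1))
            (s, (ecost e1 + ecost e2).+1)
            (iota (eval s e1) (eval s e2 - eval s e1))
  | CMatMul c a b e =>
      (set_product s c a b (eval s e), (ecost e + mm (eval s e)).+1)
  end.

(** * The algorithm *)

Definition assign (l e : expr) : cmd :=
  match l with
  | EVar x => CSet x e
  | EGet a e1 e2 => CPut a e1 e2 e
  | _ => CSkip
  end.

Module ProgNotations.
Declare Scope prog_scope.
Delimit Scope prog_scope with prog.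
Bind Scope prog_scope with expr.
Bind Scope prog_scope with cmd.
Coercion ELit : nat >-> expr.
Coercion EVar : var >-> expr.
Notation "a $[ x ]" := (EGet a x (ELit 0)) (at level 2) : prog_scope.
Notation "a $[ x , y ]" := (EGet a x y) (at level 2) : prog_scope.
Notation "l '<:-' e" := (assign l e) (at level 80) : prog_scope.
Notation "c ;; c'" := (CSeq c c') (at level 90, right associativity)
  : prog_scope.
Notation "'FOR' x 'FROM' a 'TO' b 'DO' c 'OD'" := (CFor x a b c)
  (at level 0, a at level 70, b at level 70, c at level 95) : prog_scope.
Notation "'WHEN' b 'THEN' c 'FI'" := (CIf b c CSkip)
  (at level 0, b at level 75, c at level 95) : prog_scope.
Notation "'WHEN' b 'THEN' c 'ELSE' c' 'FI'" := (CIf b c c')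
  (at level 0, b at level 75, c at level 95, c' at level 95) : prog_scope.
Notation "a + b" := (EAdd a b) : prog_scope.
Notation "a %/ b" := (EDiv a b) : prog_scope.
Notation "a <= b" := (ELe a b) : prog_scope.
Notation "a < b" := (ELt a b) : prog_scope.
End ProgNotations.

Section Program.
Import ProgNotations.
Local Open Scope prog_scope.

(* Counting sort: POS[v] is the position of v in a list of the vertices in
   non-decreasing order of degree. *)
Definition sort_by_degree : cmd :=
  FOR xd FROM 0 TO nv + 1 DO START$[xd] <:- 0 OD;;
  FOR xv FROM 0 TO nv DO
    START$[DEG$[xv] + 1] <:- START$[DEG$[xv] + 1] + 1
  OD;;
  FOR xd FROM 0 TO nv DO START$[xd + 1] <:- START$[xd + 1] + START$[xd] OD;;
  FOR xv FROM 0 TO nv DO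
    POS$[xv] <:- START$[DEG$[xv]];;
    START$[DEG$[xv]] <:- START$[DEG$[xv]] + 1
  OD.

Definition orient_edges : cmd :=
  FOR xv FROM 0 TO nv DO
    OUTDEG$[xv] <:- 0;;
    INDEG$[xv] <:- 0;;
    FOR xj FROM 0 TO DEG$[xv] DO
      xw <:- ADJ$[xv, xj];;
      WHEN POS$[xv] < POS$[xw] THEN
        OUT$[xv, OUTDEG$[xv]] <:- xw;;
        OUTDEG$[xv] <:- OUTDEG$[xv] + 1
      ELSE
        IN$[xv, INDEG$[xv]] <:- xw;;
        INDEG$[xv] <:- INDEG$[xv] + 1
      FI
    OD
  OD.

Definition count_low : cmd :=
  cnt <:- 0;;
  FOR xv FROM 0 TO nv DO MARK$[xv] <:- 0 OD;;
  FOR xv FROM 0 TO nv DO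
    FOR xj FROM 0 TO OUTDEG$[xv] DO MARK$[OUT$[xv, xj]] <:- 1 OD;;
    FOR xj FROM 0 TO INDEG$[xv] DO
      xw <:- IN$[xv, xj];;
      WHEN DEG$[xw] <= thr THEN
        FOR xk FROM 0 TO OUTDEG$[xw] DO
          xu <:- OUT$[xw, xk];;
          WHEN MARK$[xu] THEN cnt <:- cnt + 1 FI
        OD
      FI
    OD;;
    FOR xj FROM 0 TO OUTDEG$[xv] DO MARK$[OUT$[xv, xj]] <:- 0 OD
  OD.

(* With A the adjacency matrix of G_delta, the sum of the entries of A * A
   over the nonzero entries of A is the trace of A ^ 3, which is six times the
   number of triangles. *)
Definition count_high : cmd :=
  xN <:- 0;;
  FOR xv FROM 0 TO nv DO
    WHEN thr < DEG$[xv] THEN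
      IDX$[xv] <:- xN;;
      HIGH$[xN] <:- xv;;
      xN <:- xN + 1
    FI
  OD;;
  FOR xi FROM 0 TO xN DO FOR xj FROM 0 TO xN DO MA$[xi, xj] <:- 0 OD OD;;
  FOR xi FROM 0 TO xN DO
    xv <:- HIGH$[xi];;
    FOR xj FROM 0 TO DEG$[xv] DO
      xw <:- ADJ$[xv, xj];;
      WHEN thr < DEG$[xw] THEN MA$[xi, IDX$[xw]] <:- 1 FI
    OD
  OD;;
  CMatMul MB MA MA xN;;
  xtot <:- 0;;
  FOR xi FROM 0 TO xN DO
    FOR xj FROM 0 TO xN DO
      WHEN MA$[xi, xj] THEN xtot <:- xtot + MB$[xi, xj] FI
    OD
  OD;;
  cnt <:- cnt + xtot %/ 6.

Definition CountTrianglesFMM : cmd :=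
  sort_by_degree;; orient_edges;; count_low;; count_high.

End Program.

(* The store holds G as adjacency lists, each in arbitrary order, and the
   threshold delta; the rest of the memory is arbitrary.  Degrees being
   natural numbers, comparing them with delta >= 0 amounts to comparing them
   with its integer part. *)
Definition input_store (R : realType) (n : nat) (e : rel 'I_n) (dl : R)
    (s : store) : Prop :=
  [/\ reg s nv = n, reg s thr = Num.truncn dl &
   forall x : 'I_n, cell s DEG x 0 = deg e x /\
     perm_eq [seq cell s ADJ x p | p <- iota 0 (deg e x)]
             [seq val y | y <- enum 'I_n & e x y]].

(* Main.v *)
(* The program takes time linear in the size of G except in two places: the low
   phase costs the sum of the squared out-degrees of the vertices of degree at
   most delta, and the high phase costs O(h^2) and one product of h x h matrices,
   where h is the number of vertices of degree more than delta.
   The out-degree of v is at most the number of its neighbors of degree at least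
   deg v, so PLB neighborhoods bound its square by a multiple of
   (log n)^2 + (t+1)^(2 alpha - 4) (deg v)^(6 - 2 alpha).  Cutting the degrees
   into dyadic buckets, the d-th of which has at most
   c1 n (t+1)^(alpha - 1) 2^(d (1 - alpha)) vertices, turns every sum over
   vertices into a geometric series: its ratio 2^(7 - 3 alpha) is more than 1 in
   the low phase (this is alpha < 7/3), so the last bucket, near delta,
   dominates, while for h the ratio 2^(1 - alpha) is less than 1 and the first
   one does.  Both phases then cost W = n^a (t+1)^b, with h = O(W^(1/omega)), and
   alpha < 7/3 also gives a > 1, so that n (log n)^2 is absorbed.

   For correctness, the three vertices of a triangle are sorted by their position
   in the degree order; a triangle is counted in the low or in the high phase
   according to the degree of its first vertex. *)
Require Import Defs.
From mathcomp Require Import all_boot all_order all_algebra.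
From mathcomp Require Import all_classical all_reals all_analysis.
From mathcomp Require Import zify ring lra.
Import Order.TTheory GRing.Theory Num.Theory.

Set Implicit Arguments.
Unset Strict Implicit.
Unset Printing Implicit Defensive.

Local Open Scope nat_scope.

(** * Cost-aware program logic *)

Fixpoint writes_reg (c : cmd) (y : var) : bool :=
  match c with
  | CSkip | CPut _ _ _ _ | CMatMul _ _ _ _ => false
  | CSet x _ => var_beq x y
  | CSeq c1 c2 | CIf _ c1 c2 => writes_reg c1 y || writes_reg c2 y
  | CFor x _ _ c1 => var_beq x y || writes_reg c1 y
  end.

Fixpoint writes_arr (c : cmd) (b : arr) : bool :=
  match c with
  | CSkip | CSet _ _ => false
  | CPut a _ _ _ | CMatMul a _ _ _ => arr_beq a b
  | CSeq c1 c2 | CIf _ c1 c2 => writes_arr c1 b || writes_arr c2 b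
  | CFor _ _ _ c1 => writes_arr c1 b
  end.

(** The syntactic half of every specification: postconditions mention only what a command changes,
    and everything else is recovered from the frame. *)
Definition frame (c : cmd) (s s' : store) : Prop :=
  (forall y, ~~ writes_reg c y -> reg s' y = reg s y) /\
  (forall b, ~~ writes_arr c b -> cell s' b = cell s b).

(** Since [exec] is a total function, this is total correctness together with a step bound, for one
    given initial store. *)
Definition ensures (mm : nat -> nat) (c : cmd) (s : store) (w : nat)
    (Q : store -> Prop) : Prop :=
  Q (exec mm c s).1 /\ (exec mm c s).2 <= w.

Section Semantics.
Variable mm : nat -> nat.

Lemma exec_frame c s : frame c s (exec mm c s).1.
Proof.
elim: c s => [|x e|a e1 e2 e|c1 IH1 c2 IH2|e c1 IH1 c2 IH2|x e1 e2 c IH|c a b e] s.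
- by [].
- by split=> [y|//] /= /negbTE->.
- by split=> [//|b] /= /negbTE-> /=.
- have [r1 a1] := IH1 s; have [r2 a2] := IH2 (exec mm c1 s).1.
  split=> [y|b] /=; rewrite negb_or => /andP[n1 n2].
    by rewrite r2 // r1.
  by rewrite a2 // a1.
- have [r1 a1] := IH1 s; have [r2 a2] := IH2 s.
  by split=> [y|b] /=; rewrite negb_or => /andP[n1 n2];
    case: ifP => _; rewrite ?r1 ?r2 ?a1 ?a2.
- rewrite /exec -/exec /=; move: (iota _ _) (_.+1) => l k.
  elim: l s k => [|m l IHl] s k //=.
  have [r1 a1] := IH (set_reg s x m).
  have [r2 a2] := IHl (exec mm c (set_reg s x m)).1 (k + (exec mm c (set_reg s x m)).2).+1.
  split=> [y|b] /= nw.
    rewrite r2 //; move: nw; rewrite negb_or => /andP[n1 n2].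
    by rewrite r1 //= (negbTE n1).
  by rewrite a2 // a1.
- by split=> [//|b'] /= /negbTE-> /=.
Qed.

Lemma ensures_seq c1 c2 s w1 w2 (Q Q' : store -> Prop) :
  ensures mm c1 s w1 Q' ->
  (forall s', Q' s' -> frame c1 s s' -> ensures mm c2 s' w2 Q) ->
  ensures mm (CSeq c1 c2) s (w1 + w2) Q.
Proof.
move=> [q1 k1] h; have [q2 k2] := h _ q1 (exec_frame c1 s).
by split=> //=; apply: leq_add.
Qed.

Lemma ensures_weaken c s w w' (Q Q' : store -> Prop) :
  ensures mm c s w Q -> w <= w' ->
  (forall s', Q s' -> frame c s s' -> Q' s') -> ensures mm c s w' Q'.
Proof.
move=> [q k] lew h; split; first exact: h _ q (exec_frame c s).
exact: leq_trans k lew.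
Qed.

(** Both loop bounds are evaluated once, on entry, so [N] is fixed. The step also receives the frame
    of the whole loop relative to the store at entry; invariants need not repeat what the loop
    leaves alone. *)
Lemma ensures_for x e1 e2 c s (I : nat -> store -> Prop) (w : nat -> nat) N :
  Defs.eval s e1 = 0 -> Defs.eval s e2 = N -> I 0 s ->
  (forall m s', m < N -> I m s' -> frame (CFor x e1 e2 c) s s' ->
     ensures mm c (set_reg s' x m) (w m) (I m.+1)) ->
  ensures mm (CFor x e1 e2 c) s
    ((ecost e1 + ecost e2).+1 + \sum_(m < N) (w m).+1) (I N).
Proof.
move=> h1 h2 I0 step.
(* The state after [M] iterations. Splitting the last index off [iota] lets the induction run
   forward from the initial store. *)
pose run M := foldl (fun r m =>
   let r' := exec mm c (set_reg r.1 x m) in (r'.1, (r.2 + r'.2).+1))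
   (s, (ecost e1 + ecost e2).+1) (iota 0 M).
have runS M : run M.+1 =
    ((exec mm c (set_reg (run M).1 x M)).1,
     ((run M).2 + (exec mm c (set_reg (run M).1 x M)).2).+1).
  by rewrite /run -[in iota 0 _]addn1 iotaD cats1 foldl_rcons.
have -> : ensures mm (CFor x e1 e2 c) s
    ((ecost e1 + ecost e2).+1 + \sum_(m < N) (w m).+1) (I N) =
    (I N (run N).1 /\
     (run N).2 <= (ecost e1 + ecost e2).+1 + \sum_(m < N) (w m).+1).
  by rewrite /ensures /= h1 h2 subn0.
have : forall M, M <= N -> [/\ I M (run M).1,
     (run M).2 <= (ecost e1 + ecost e2).+1 + \sum_(m < M) (w m).+1
     & frame (CFor x e1 e2 c) s (run M).1].
  elim=> [|M IH] ltMN.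
    by split=> //; rewrite big_ord0 addn0.
  have [IM kM fM] := IH (ltnW ltMN); rewrite runS /=.
  have [IM1 k] := step M _ ltMN IM fM.
  split=> //; first by rewrite big_ord_recr /= addnA addnS ltnS leq_add.
  have [r1 a1] := exec_frame c (set_reg (run M).1 x M).
  have [r2 a2] := fM.
  split=> [y|b] nw /=; last by rewrite a1 //= a2.
  have := nw; rewrite /= negb_or => /andP[n1 n2].
  by rewrite r1 //= (negbTE n1) r2.
by move=> /(_ N (leqnn N)) [].
Qed.

Lemma ensures_if e c1 c2 s w (Q : store -> Prop) :
  (Defs.eval s e != 0 -> ensures mm c1 s w Q) ->
  (Defs.eval s e == 0 -> ensures mm c2 s w Q) ->
  ensures mm (CIf e c1 c2) s (ecost e + w).+1 Q.
Proof.
move=> h1 h2; rewrite /ensures /=.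
case: ifP => [/h2 [q k]|/negbT /h1 [q k]]; split=> //;
  by rewrite ltnS leq_add2l.
Qed.

Lemma ensures_set x e s (Q : store -> Prop) :
  Q (set_reg s x (Defs.eval s e)) ->
  ensures mm (assign (EVar x) e) s (ecost e).+1 Q.
Proof. by []. Qed.

Lemma ensures_put a e1 e2 e s (Q : store -> Prop) :
  Q (Defs.set_mem s a (Defs.eval s e1) (Defs.eval s e2) (Defs.eval s e)) ->
  ensures mm (assign (EGet a e1 e2) e) s
    (ecost e1 + ecost e2 + ecost e).+1 Q.
Proof. by []. Qed.

End Semantics.

(** * Verification of the program *)

Lemma count_iotaS (p : pred nat) m :
  count p (iota 0 m.+1) = count p (iota 0 m) + p m.
Proof. by rewrite -[in iota 0 _]addn1 iotaD count_cat /= addn0. Qed.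

Lemma sum_iota0 n (P : pred nat) (F : nat -> nat) :
  \sum_(i <- iota 0 n | P i) F i = \sum_(i < n | P i) F i.
Proof. by rewrite -(big_mkord P F) /index_iota subn0. Qed.

Section Algorithm.
Variables (mm : nat -> nat) (n : nat) (A : rel nat).
Hypothesis A_lt : forall x y, A x y -> y < n.
Hypothesis A_sym : symmetric A.
Hypothesis A_irr : irreflexive A.

(** * Degrees and the sorted order of the vertices *)

Definition dg x := count (A x) (iota 0 n).

Lemma dg_lt x : x < n -> dg x < n.
Proof.
move=> xn; rewrite /dg -{2}(size_iota 0 n) ltn_neqAle count_size andbT.
rewrite -all_count; apply/negP => /allP /(_ x).
by rewrite mem_iota A_irr /= => /(_ xn).
Qed.

(** The place that a stable counting sort assigns to [x]: after all vertices of smaller degree and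
    after those of equal degree with a smaller number. *)
Definition pos x :=
  count (fun u => dg u < dg x) (iota 0 n) +
  count (fun u => dg u == dg x) (iota 0 x).

Definition before x y := pos x < pos y.

(** If [dg u < dg v], the vertices of degree at most [dg u], with [u] among them, all count in the
    first summand of [pos v]. At equal degrees only the second summand differs. *)
Lemma before_lex x y : x < n -> y < n ->
  before x y = (dg x < dg y) || (dg x == dg y) && (x < y).
Proof.
have lt1 u v : u < n -> dg u < dg v -> pos u < pos v.
  move=> un duv; rewrite /pos.
  apply: (@leq_trans (count (fun w => dg w < dg u) (iota 0 n) +
                      count (fun w => dg w == dg u) (iota 0 n))).
    rewrite -addnS leq_add2l -(subnKC un) iotaD count_cat count_iotaS /= eqxx.
    by rewrite addn1 leq_addr.
  rewrite -count_predUI [X in _ + X](@eq_count _ _ pred0) ?count_pred0 ?addn0.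
    apply: leq_trans (leq_addr _ _); apply: sub_count => w /=; lia.
  by move=> w /=; lia.
have lt2 u v : dg u = dg v -> u < v -> pos u < pos v.
  move=> duv uv; rewrite /pos duv ltn_add2l.
  rewrite -[in iota 0 v](subnKC uv) iotaD count_cat count_iotaS /= duv eqxx.
  by rewrite addn1 leq_addr.
move=> xn yn; rewrite /before.
case: (ltngtP (dg x) (dg y)) => /= [h|h|h].
- exact: lt1.
- by apply/negbTE; rewrite -leqNgt ltnW // lt1.
case: (ltngtP x y) => h'.
- exact: lt2.
- by apply/negbTE; rewrite -leqNgt ltnW // lt2.
- by rewrite h' ltnn.
Qed.

Lemma sort_by_degree_spec s :
  reg s nv = n -> (forall x, x < n -> cell s DEG x 0 = dg x) ->
  ensures mm sort_by_degree s (100 * n.+1)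
    (fun s' => forall x, x < n -> cell s' POS x 0 = pos x).
Proof.
move=> snv sdeg; eapply ensures_weaken.
- eapply ensures_seq.
    eapply (ensures_for (N := n.+1) (w := fun _ => _)
      (I := fun m s' => forall d, d < m -> cell s' START d 0 = 0)) => //.
      by rewrite /= snv addn1.
    move=> m s' ltmn IH _; split; last exact: leqnn.
    move=> d /=; case: eqP => //= ne; rewrite ltnS leq_eqVlt => /orP[/eqP//|].
    exact: IH.
  move=> s1 h1 [f1 g1].
  eapply ensures_seq.
    (* Counts are stored one cell higher: cell [d + 1] receives the number of vertices of degree
       [d]. The index stays within [n] because degrees are below [n]. *)
    eapply (ensures_for (N := n) (w := fun _ => _)
      (I := fun m s' => forall d, d <= n ->
        cell s' START d 0 = count (fun u => (dg u).+1 == d) (iota 0 m))) => //.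
      by rewrite /= f1.
    move=> m s' ltmn IH [_ g2]; split; last exact: leqnn.
    move=> d led; rewrite count_iotaS /= g2 // g1 // sdeg // !addn1.
    rewrite !IH ?(dg_lt ltmn) // andbT eq_sym.
    by case: eqP => [<-|_]; rewrite ?addn1 ?addn0.
  move=> s2 h2 [f2 g2].
  eapply ensures_seq.
    (* The shift makes the prefix sums strict: a finished cell [d] counts the vertices of degree
       less than [d], which is where the block of degree [d] begins. Cells beyond [m] still hold the
       shifted counts. *)
    eapply (ensures_for (N := n) (w := fun _ => _)
      (I := fun m s' => forall d, d <= n ->
        cell s' START d 0 = if d <= m then count (fun u => dg u < d) (iota 0 n)
          else count (fun u => (dg u).+1 == d) (iota 0 n))) => //=.
    - by rewrite f2 // f1.
    - move=> d led; rewrite h2 // leqn0; case: eqP => // ->.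
      by apply: eq_count => u.
    move=> m s' ltmn IH _; split; last exact: leqnn.
    move=> d led; rewrite /= !addn1 andbT !IH //; last exact: ltnW.
    rewrite ltnn leqnn; case: (ltngtP d m.+1) => h.
    - by rewrite -ltnS h.
    - by rewrite leqNgt ltnW.
    rewrite h -count_predUI [X in _ + X](@eq_count _ _ pred0).
      by rewrite count_pred0 addn0; apply: eq_count => u /=; lia.
    by move=> u /=; lia.
  move=> s3 h3 [f3 g3].
  (* Cell [d] is now the next free position in the block of degree [d]; when vertex [m] is reached,
     the cell of its degree holds [pos m]. *)
  apply: (ensures_for (N := n) (w := fun _ => 30)
    (I := fun m s' => (forall d, d <= n -> cell s' START d 0 =
        count (fun u => dg u < d) (iota 0 n) +
        count (fun u => dg u == d) (iota 0 m)) /\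
        (forall x, x < m -> cell s' POS x 0 = pos x))) => //.
  - by rewrite /= f3 // f2 // f1.
  - by split=> // d led; rewrite h3 // led addn0.
  move=> m s' ltmn [IH1 IH2] [_ g4].
  have sm : cell s' DEG m 0 = dg m by rewrite g4 // g3 // g2 // g1 // sdeg.
  have := ltnW (dg_lt ltmn) => ldm.
  split; last by [].
  split=> [d led|x]; rewrite ?count_iotaS /= !sm.
    rewrite !IH1 // addn1 andbT eq_sym.
    by case: eqP => [<-|_]; rewrite ?addn0 ?addn1 ?addnS.
  rewrite andbT ltnS leq_eqVlt; case: eqP => //= [->|_] ltx; last exact: IH2.
  by rewrite IH1.
- by rewrite /= !sum_nat_const !card_ord; lia.
- by move=> s' [_ h] _.
Qed.

(** * Neighbor lists in memory and the orientation of edges *)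

Definition stores (s : store) (a len : arr) (x : nat) (l : seq nat) : Prop :=
  cell s len x 0 = size l /\ mkseq (cell s a x) (size l) = l.

Lemma stores_nth s a len x l j :
  stores s a len x l -> j < size l -> cell s a x j = nth 0 l j.
Proof. by move=> [_ hl] lj; rewrite -hl nth_mkseq. Qed.

Lemma stores_same s s' a len x l :
  stores s a len x l -> cell s' len x 0 = cell s len x 0 ->
  (forall j, j < size l -> cell s' a x j = cell s a x j) ->
  stores s' a len x l.
Proof.
move=> [h1 h2] e1 e2; split; first by rewrite e1.
rewrite -{2}h2; apply/eq_in_map => j; rewrite mem_iota /=; exact: e2.
Qed.

Lemma stores_rcons s s' a len x l y :
  stores s a len x l -> cell s' len x 0 = (size l).+1 ->
  cell s' a x (size l) = y ->
  (forall j, j < size l -> cell s' a x j = cell s a x j) ->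
  stores s' a len x (rcons l y).
Proof.
move=> [h1 h2] e1 ey e2; split; first by rewrite e1 size_rcons.
rewrite size_rcons /mkseq -[in iota 0 _]addn1 iotaD map_cat /= ey cats1.
congr rcons; rewrite -{2}h2.
by apply/eq_in_map => j; rewrite mem_iota /=; exact: e2.
Qed.

Variable L : nat -> seq nat.
Hypothesis L_perm : forall x, x < n ->
  perm_eq (L x) [seq y <- iota 0 n | A x y].

Lemma size_L x : x < n -> size (L x) = dg x.
Proof. by move=> xn; rewrite (perm_size (L_perm xn)) size_filter. Qed.

Lemma mem_L x y : x < n -> (y \in L x) = A x y.
Proof.
move=> xn; rewrite (perm_mem (L_perm xn)) mem_filter mem_iota /= add0n.
by apply: andb_idr => /A_lt.
Qed.

(** Filtered from the input lists [L], which enumerate neighbors in an arbitrary order, so that the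
    entries appear in the order in which the program appends them. *)
Definition outl x := [seq y <- L x | before x y].
Definition inl x := [seq y <- L x | ~~ before x y].

Lemma orient_edges_spec s :
  reg s nv = n -> (forall x, x < n -> stores s ADJ DEG x (L x)) ->
  (forall x, x < n -> cell s POS x 0 = pos x) ->
  ensures mm orient_edges s (30 + \sum_(x < n) (30 * dg x + 30))
    (fun s' => forall x, x < n ->
       stores s' OUT OUTDEG x (outl x) /\ stores s' IN INDEG x (inl x)).
Proof.
move=> snv sadj spos; eapply ensures_weaken.
- apply: (ensures_for (N := n) (w := fun x => 29 + 30 * dg x)
      (I := fun m s' => forall x, x < m ->
       stores s' OUT OUTDEG x (outl x) /\ stores s' IN INDEG x (inl x))) => //.
  move=> m s1 mn IH [f1 g1].
  have dm : cell s DEG m 0 = size (L m) by case: (sadj _ mn).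
  eapply ensures_weaken.
  + eapply ensures_seq; first exact: ensures_put (erefl _).
    move=> _ <- _.
    eapply ensures_seq; first exact: ensures_put (erefl _).
    move=> _ <- _.
    (* After [j] neighbors of [m], its two lists are the filters of the first [j] entries of [L m];
       the finished lists of earlier vertices lie in other rows. *)
    apply: (ensures_for (N := size (L m)) (w := fun _ => 28)
      (I := fun j s' => (forall x, x < m ->
       stores s' OUT OUTDEG x (outl x) /\ stores s' IN INDEG x (inl x)) /\
       stores s' OUT OUTDEG m [seq y <- take j (L m) | before m y] /\
       stores s' IN INDEG m [seq y <- take j (L m) | ~~ before m y])).
    * by [].
    * by rewrite /= g1.
    * split; last by rewrite take0 /stores /= !eqxx.
      move=> x xm; have [h1 h2] := IH _ xm.
      by split; [apply: (stores_same h1)|apply: (stores_same h2)];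
        rewrite /= ?(ltn_eqF xm).
    move=> j s2 jm [IHx [IHo IHi]] [f2 g2].
    have e2 : cell s2 ADJ m j = nth 0 (L m) j.
      by rewrite g2 //= g1 // (stores_nth (sadj _ mn) jm).
    have xv2 : reg s2 xv = m by rewrite f2.
    set w := nth 0 (L m) j in e2.
    have wn : w < n by apply: (@A_lt m); rewrite -mem_L // mem_nth.
    have p2 x : x < n -> cell s2 POS x 0 = pos x.
      by move=> xn; rewrite g2 //= g1 // spos.
    have [lo _] := IHo; have [li _] := IHi.
    rewrite /ensures /= xv2 e2 !p2 // -/(before m w) (take_nth 0 jm).
    rewrite !filter_rcons -/w.
    case: (before m w) => /=; rewrite ?xv2 ?lo ?li; split=> //.
    * split=> [x xm|].
        have [h1 h2] := IHx _ xm.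
        by split; [apply: (stores_same h1)|apply: (stores_same h2)];
          rewrite //= ?(ltn_eqF xm).
      split; last exact: (stores_same IHi).
      apply: (stores_rcons IHo); rewrite /= ?eqxx ?addn1 //.
      by move=> i /ltn_eqF; rewrite eq_sym => ->; rewrite andbF.
    * split=> [x xm|].
        have [h1 h2] := IHx _ xm.
        by split; [apply: (stores_same h1)|apply: (stores_same h2)];
          rewrite //= ?(ltn_eqF xm).
      split; first exact: (stores_same IHo).
      apply: (stores_rcons IHi); rewrite /= ?eqxx ?addn1 //.
      by move=> i /ltn_eqF; rewrite eq_sym => ->; rewrite andbF.
  + by rewrite /= sum_nat_const card_ord size_L //; lia.
  + move=> s' [h1 [h2 h3]] _ x; rewrite ltnS leq_eqVlt => /orP[/eqP->|]; last exact: h1.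
    by rewrite take_size in h2 h3; split.
- rewrite /=; apply: leq_add => //; apply: leq_sum => x _; lia.
- by [].
Qed.

(** * The low phase *)

Lemma mark_loop_spec b s v l :
  reg s xv = v -> stores s OUT OUTDEG v l ->
  ensures mm (CFor xj (ELit 0) (EGet OUTDEG (EVar xv) (ELit 0))
     (assign (EGet MARK (EGet OUT (EVar xv) (EVar xj)) (ELit 0)) (ELit b))) s
    (10 * size l + 10)
    (fun s' => forall u,
       cell s' MARK u 0 = if u \in l then b else cell s MARK u 0).
Proof.
move=> sv sl; have [ls _] := sl; eapply ensures_weaken.
- eapply (ensures_for (N := size l) (w := fun _ => _)
    (I := fun j s' => forall u,
       cell s' MARK u 0 = if u \in take j l then b else cell s MARK u 0)) => //.
  + by rewrite /= sv.
  + by move=> u; rewrite take0.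
  move=> j s' jl IH [f1 g1]; split; last exact: leqnn.
  move=> u; rewrite (take_nth 0 jl) mem_rcons inE /= f1 //= sv g1 //.
  rewrite (stores_nth sl jl) andbT.
  by case: eqP => //= _; rewrite IH.
- by rewrite /= sum_nat_const card_ord; lia.
- by move=> s' h _ u; rewrite h take_size.
Qed.

Variable T : nat.

(** The contribution of [v] as middle vertex: pairs of arcs [w -> v], [w -> u] with [w] low that are
    closed by the arc [v -> u]. *)
Definition low_count v :=
  \sum_(w <- inl v | dg w <= T) \sum_(u <- outl w) (u \in outl v).

Definition low_cost v :=
  40 * size (outl v) + 50 +
  \sum_(w <- inl v) (30 + (dg w <= T) * (30 * size (outl w))).

Lemma count_low_spec s :
  reg s nv = n -> reg s thr = T ->
  (forall x, x < n -> cell s DEG x 0 = dg x) ->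
  (forall x, x < n -> stores s OUT OUTDEG x (outl x)) ->
  (forall x, x < n -> stores s IN INDEG x (inl x)) ->
  ensures mm count_low s (50 + 50 * n + \sum_(v < n) low_cost v)
    (fun s' => reg s' cnt = \sum_(v < n) low_count v).
Proof.
move=> snv sthr sdeg sout sin; eapply ensures_weaken.
- eapply ensures_seq; first exact: ensures_set (erefl _).
  move=> _ <- _; eapply ensures_seq.
    eapply (ensures_for (N := n) (w := fun _ => _)
      (I := fun m s' => reg s' cnt = 0 /\
         forall u, u < m -> cell s' MARK u 0 = 0)) => //.
    move=> m s' ltmn [IH0 IH] _; split; last exact: leqnn.
    split=> // u /=; case: eqP => //= ne; rewrite ltnS leq_eqVlt => /orP[/eqP//|].
    exact: IH.
  move=> s1 [c1 mk1] [f1 g1].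
  (* Between passes [MARK] is zero on all vertices: the last loop of a pass clears exactly the cells
     set by the first, so resetting costs only the out-degree, up to a constant. *)
  eapply (ensures_for (N := n) (w := fun v => 49 + 40 * size (outl v) +
      \sum_(w <- inl v) (30 + (dg w <= T) * (30 * size (outl w))))
    (I := fun m s' => (forall u, u < n -> cell s' MARK u 0 = 0) /\
       reg s' cnt = \sum_(v < m) low_count v)).
  + by [].
  + by rewrite /= f1.
  + by rewrite big_ord0.
  move=> v s2 vn [mk2 c2] [f2 g2].
  have out2 x : x < n -> stores s2 OUT OUTDEG x (outl x).
    by move=> xn; apply: (stores_same (sout x xn)); rewrite g2 // g1.
  have in2 x : x < n -> stores s2 IN INDEG x (inl x).
    by move=> xn; apply: (stores_same (sin x xn)); rewrite g2 // g1.
  have deg2 x : x < n -> cell s2 DEG x 0 = dg x.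
    by move=> xn; rewrite g2 // g1 // sdeg.
  have thr2 : reg s2 thr = T by rewrite f2 // f1.
  have inl_lt w : w \in inl v -> w < n.
    by rewrite mem_filter mem_L // => /andP[_ /A_lt].
  have outl_lt w u : w < n -> u \in outl w -> u < n.
    by move=> wn; rewrite mem_filter mem_L // => /andP[_ /A_lt].
  eapply ensures_weaken.
  + eapply ensures_seq; first by apply: (@mark_loop_spec _ _ v); last exact: out2.
    move=> s3 mk3 [f3 g3].
    eapply ensures_seq.
      eapply (ensures_for (N := size (inl v))
       (w := fun j => 29 + (dg (nth 0 (inl v) j) <= T) *
          (30 * size (outl (nth 0 (inl v) j))))
       (I := fun j s' => reg s' cnt = \sum_(x < v) low_count x +
          \sum_(w <- take j (inl v) | dg w <= T)
             \sum_(u <- outl w) (u \in outl v))).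
      * by [].
      * by rewrite /= f3 // g3 //=; case: (in2 v vn).
      * by rewrite take0 big_nil addn0 f3.
      move=> j s4 jl IH [f4 g4]; set w := nth 0 (inl v) j.
      have winl : w \in inl v by apply: mem_nth.
      have wn := inl_lt _ winl.
      have e4 : cell s4 IN v j = w.
        by rewrite g4 // g3 //= (stores_nth (in2 v vn) jl).
      have v4 : reg s4 xv = v by rewrite f4 // f3.
      have d4 : cell s4 DEG w 0 = dg w by rewrite g4 // g3 //= deg2.
      have t4 : reg s4 thr = T by rewrite f4 // f3.
      eapply ensures_weaken.
      * eapply ensures_seq; first exact: ensures_set (erefl _).
        move=> _ <- _; rewrite /= v4 e4.
        apply: (@ensures_if _ _ _ _ _ ((dg w <= T) * (29 * size (outl w)) + 10)
         (fun s' => reg s' cnt = \sum_(x < v) low_count x +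
          \sum_(w <- take j.+1 (inl v) | dg w <= T)
             \sum_(u <- outl w) (u \in outl v))) => /=.
        - rewrite d4 t4; case: leqP => // dwT _.
          eapply ensures_weaken.
          + eapply (ensures_for (N := size (outl w)) (w := fun _ => 20)
             (I := fun k s' => reg s' cnt = \sum_(x < v) low_count x +
              \sum_(w <- take j (inl v) | dg w <= T)
               \sum_(u <- outl w) (u \in outl v) +
              \sum_(u <- take k (outl w)) (u \in outl v))).
            * by [].
            * by rewrite /= g4 // g3 //=; case: (out2 w wn).
            * by rewrite take0 big_nil addn0 /=.
            move=> k s5 kl IHk [f5 g5].
            have w5 : reg s5 xw = w by rewrite f5.
            set u := nth 0 (outl w) k.
            have un : u < n by apply: (outl_lt w) => //; exact: mem_nth.
            have e5 : cell s5 OUT w k = u.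
              by rewrite g5 //= g4 // g3 //= (stores_nth (out2 w wn) kl).
            have mk5 : cell s5 MARK u 0 = (u \in outl v).
              by rewrite g5 //= g4 // mk3 /= mk2 //; case: ifP.
            rewrite /ensures /= w5 e5 mk5 (take_nth 0 kl) -cats1 big_cat.
            rewrite big_seq1 -/u /=.
            by case: (u \in outl v); rewrite /= IHk ?addn0 ?addn1 ?addnS.
          + by rewrite /= sum_nat_const card_ord mul1n; lia.
          + move=> s' + _; rewrite take_size => ->.
            by rewrite (take_nth 0 jl) -cats1 big_cat /= big_cons big_nil -/w dwT
              addn0 addnA.
        - rewrite d4 t4; case: leqP => // dwT _; split; last by rewrite addn_gt0.
          by rewrite /= IH (take_nth 0 jl) -cats1 big_cat /= big_cons big_nil -/w
            leqNgt dwT /= addn0.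
      * by rewrite /= -/w; case: (dg w <= T) => /=; lia.
      * by [].
    move=> s4 c4 [f4 g4].
    apply: (@ensures_weaken _ _ _ _ _ _
      (fun s' => (forall u, u < n -> cell s' MARK u 0 = 0) /\
         reg s' cnt = \sum_(x < v.+1) low_count x)
      (@mark_loop_spec _ _ v (outl v) _ _)).
    * by rewrite f4 // f3.
    * by apply: (stores_same (out2 v vn)); rewrite g4 // g3.
    * exact: leqnn.
    move=> s5 mk5 [f5 g5].
    split.
    * move=> u un; rewrite mk5 g4 // mk3 /= mk2 //.
      by case: (u \in outl v).
    * by rewrite f5 // c4 take_size big_ord_recr.
  + rewrite /=.
    rewrite (big_nth 0) big_mkord.
    under [X in _ + (_ + X + _) <= _]eq_bigr => i _ do rewrite -addSn.
    set S1 := (X in _ + (_ + X + _) <= _); rewrite -[X in _ <= _ + X]/S1; lia.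
  + by move=> s' [? ?].
- rewrite /= sum_nat_const card_ord.
  have -> : \sum_(v < n) low_cost v = \sum_(m < n) (49 + 40 * size (outl m) +
      \sum_(w <- inl m) (30 + (dg w <= T) * (30 * size (outl w)))).+1.
    by apply: eq_bigr => v _; rewrite /low_cost; lia.
  set S1 := bigop _ _ _; lia.
- by move=> s' [].
Qed.

(** * The high phase *)

Definition high := [seq v <- iota 0 n | T < dg v].

Lemma mem_high v : (v \in high) = (T < dg v) && (v < n).
Proof. by rewrite mem_filter mem_iota. Qed.

(** The trace of the cube of the adjacency matrix of [G_delta], in the form in which the program
    sums it. *)
Definition closed_walks :=
  \sum_(x <- high) \sum_(y <- high)
    A x y * \sum_(z <- high) A x z * A z y.

Definition high_cost :=
  100 + 100 * n + 100 * (size high * size high) +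
  \sum_(x <- high) (100 + 100 * dg x) + mm (size high).

Lemma count_high_spec s :
  reg s nv = n -> reg s thr = T ->
  (forall x, x < n -> stores s ADJ DEG x (L x)) ->
  ensures mm count_high s high_cost
    (fun s' => reg s' cnt = reg s cnt + closed_walks %/ 6).
Proof.
move=> snv sthr sadj; set N := size high.
pose H i := nth 0 high i.
have Hhigh i : i < N -> H i \in high by exact: mem_nth.
have H_lt i : i < N -> H i < n by move/Hhigh; rewrite mem_high => /andP[].
(* The high vertices among the first [m]; [HIGH] lists them in this order and [IDX] inverts it. *)
pose highs m := [seq v <- iota 0 m | T < dg v].
have highsS m : highs m.+1 = if T < dg m then rcons (highs m) m else highs m.
  rewrite /highs -[in iota 0 _]addn1 iotaD filter_cat /= add0n.
  by case: ifP; rewrite ?cats1 ?cats0.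
eapply ensures_weaken.
- eapply ensures_seq; first exact: ensures_set (erefl _).
  move=> _ <- _; eapply ensures_seq.
    eapply (ensures_for (N := n) (w := fun _ => 40)
      (I := fun m s' => [/\ reg s' xN = size (highs m),
          forall i, i < size (highs m) -> cell s' HIGH i 0 = nth 0 (highs m) i &
          forall v, v \in highs m -> cell s' IDX v 0 = index v (highs m)])) => //.
    move=> m s1 mn [xN1 high1 idx1] [f1 g1].
    have mHm : m \notin highs m by rewrite mem_filter mem_iota add0n ltnn !andbF.
    have deg1 : cell s1 DEG m 0 = dg m.
      by rewrite g1 //=; case: (sadj m mn) => ->; rewrite size_L.
    rewrite /ensures /= deg1 f1 //= sthr highsS.
    case: (T < dg m) => //=.
    rewrite !xN1; split=> //; split.
    + by rewrite size_rcons addn1.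
    + move=> i; rewrite -cats1 size_cat addn1 ltnS leq_eqVlt nth_cat => /orP[/eqP->|ilt].
        by rewrite eqxx ltnn subnn.
      by rewrite (ltn_eqF ilt) ilt high1.
    + move=> v; rewrite -cats1 mem_cat inE index_cat andbT.
      case: (boolP (v \in highs m)) => /= [vHm _|_ /eqP->].
        case: eqP => [vm|_]; last exact: idx1.
        by rewrite vm (negbTE mHm) in vHm.
      by rewrite eqxx addn0.
  move=> s1 [xN1 high1 idx1] [f1 g1].
  rewrite /highs -/high -/N in xN1 high1 idx1.
  eapply ensures_seq.
    eapply (ensures_for (N := N) (w := fun _ => _)
      (I := fun m s' => forall i j, i < m -> j < N -> cell s' MA i j = 0)) => //.
    move=> m s2 mN IH [f2 g2]; eapply ensures_weaken.
    + eapply (ensures_for (N := N) (w := fun _ => _)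
        (I := fun k s' => (forall i j, i < m -> j < N -> cell s' MA i j = 0) /\
           (forall j, j < k -> cell s' MA m j = 0))) => //.
      * by rewrite /= f2.
      move=> k s3 kN [IH1 IH2] [f3 g3]; split; last exact: leqnn.
      rewrite /= f3 //=; split=> [i j im jN|j].
        by rewrite (ltn_eqF im) IH1.
      rewrite eqxx ltnS leq_eqVlt => /orP[/eqP->|jk]; first by rewrite eqxx.
      by rewrite (ltn_eqF jk) IH2.
    + exact: leqnn.
    + move=> s3 [h1 h2] _ i j; rewrite ltnS leq_eqVlt => /orP[/eqP->|im]; first exact: h2.
      exact: h1.
  move=> s2 ma2 [f2 g2].
  eapply ensures_seq.
    eapply (ensures_for (N := N) (w := fun i => 30 + 40 * dg (H i))
      (I := fun m s' => forall i j, i < N -> j < N ->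
         cell s' MA i j = (i < m) && A (H i) (H j))).
    + by [].
    + by rewrite /= f2.
    + by move=> i j iN jN; rewrite ma2.
    move=> m s3 mN IH [f3 g3].
    have Hm3 : cell s3 HIGH m 0 = H m by rewrite g3 // g2 // high1.
    have deg3 x : x < n -> cell s3 DEG x 0 = dg x.
      move=> xn; rewrite g3 // g2 // g1 //=.
      by case: (sadj x xn) => ->; rewrite size_L.
    eapply ensures_weaken.
    + eapply ensures_seq; first exact: ensures_set (erefl _).
      (* Row [m] fills up as the adjacency list of [H m] is read: its ones mark the high vertices
         among the first [k] neighbors. *)
      move=> _ <- _; eapply (ensures_for (N := dg (H m)) (w := fun _ => 30)
        (I := fun k s' => forall i j, i < N -> j < N ->
         cell s' MA i j =
           if i < m then A (H i) (H j)
           else (i == m) && (H j \in take k (L (H m))))).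
      * by [].
      * by rewrite /= Hm3 deg3 // H_lt.
      * by move=> i j iN jN; rewrite take0 in_nil andbF /= IH //.
      move=> k s4 kN IHk [f4 g4].
      have kL : k < size (L (H m)) by rewrite size_L // H_lt.
      set w := nth 0 (L (H m)) k.
      have wn : w < n by apply: (@A_lt (H m)); rewrite -mem_L ?H_lt // mem_nth.
      have e4 : cell s4 ADJ (H m) k = w.
        by rewrite g4 //= g3 // g2 // g1 // (stores_nth (sadj _ (H_lt _ mN)) kL).
      have v4 : reg s4 xv = H m by rewrite f4.
      have i4 : reg s4 xi = m by rewrite f4.
      have t4 : reg s4 thr = T by rewrite f4 //= f3 // f2 // f1.
      have d4 : cell s4 DEG w 0 = dg w by rewrite g4 //= deg3.
      rewrite /ensures /= v4 e4 t4 d4.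
      case: (boolP (T < dg w)) => /= dw; split=> // i j iN jN;
        rewrite (take_nth 0 kL) mem_rcons inE -/w; last first.
        have /negbTE Hjw : H j != w.
          apply: contraNneq dw => <-.
          by move: (Hhigh _ jN); rewrite mem_high => /andP[].
        by rewrite Hjw /= IHk.
      have wH : w \in high by rewrite mem_high dw.
      rewrite i4 g4 //= g3 // g2 // idx1 // IHk //.
      (* As [high] has no repetitions, [IDX] inverts [H], so the write hits the column of [w] and no
         other. *)
      have -> : (j == index w high) = (H j == w).
        apply/eqP/eqP => [->|<-]; first by rewrite /H nth_index.
        by rewrite index_uniq // filter_uniq // iota_uniq.
      case: (ltngtP i m) => _ /=; by case: (H j == w).
    + by rewrite /= sum_nat_const card_ord; lia.
    + move=> s4 h4 _ i j iN jN; rewrite h4 // ltnS.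
      rewrite -size_L ?H_lt // take_size mem_L ?H_lt //.
      by case: (ltngtP i m) => [| |->].
  move=> s3 ma3 [f3 g3].
  have xN3 : reg s3 xN = N by rewrite f3 // f2.
  have mulS : ensures mm (CMatMul MB MA MA (EVar xN)) s3 (mm N).+2
      (eq (set_product s3 MB MA MA N)).
    by rewrite /ensures /= xN3.
  eapply ensures_seq; first exact: mulS.
  move=> _ <- _; eapply ensures_seq; first exact: ensures_set (erefl _).
  move=> _ <- _; eapply ensures_seq.
    eapply (ensures_for (N := N) (w := fun _ => _)
      (I := fun m s' => reg s' xtot = \sum_(i < m) \sum_(j < N)
          A (H i) (H j) * \sum_(r < N) A (H i) (H r) * A (H r) (H j))).
    + by [].
    + by rewrite /= xN3.
    + by rewrite big_ord0.
    move=> m s4 mN IH [f4 g4].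
    eapply ensures_weaken.
    + eapply (ensures_for (N := N) (w := fun _ => 20)
       (I := fun k s' => reg s' xtot = \sum_(i < m) \sum_(j < N)
          A (H i) (H j) * (\sum_(r < N) A (H i) (H r) * A (H r) (H j)) +
          \sum_(j < k)
          A (H m) (H j) * \sum_(r < N) A (H m) (H r) * A (H r) (H j))).
      * by [].
      * by rewrite /= f4 //= xN3.
      * by rewrite big_ord0 addn0.
      move=> k s5 kN IHk [f5 g5].
      have i5 : reg s5 xi = m by rewrite f5.
      have MA5 i j : i < N -> j < N -> cell s5 MA i j = A (H i) (H j).
        by move=> iN jN; rewrite g5 //= g4 //= ma3 // iN.
      have MB5 : cell s5 MB m k = \sum_(r < N) A (H m) (H r) * A (H r) (H k).
        rewrite g5 //= g4 //= mN kN /=.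
        by apply: eq_bigr => r _; rewrite !ma3 ?mN ?ltn_ord.
      rewrite /ensures /= i5 MA5 // big_ord_recr /=.
      case: (A (H m) (H k)) => /=; last by rewrite IHk mul0n addn0.
      by rewrite IHk i5 MB5 mul1n addnA.
    + exact: leqnn.
    + move=> s5 + _ => ->; by rewrite [in RHS]big_ord_recr.
  move=> s4 tot4 [f4 g4].
  apply: (@ensures_set _ _ _ _ (fun s' => reg s' cnt =
      reg s cnt + closed_walks %/ 6)).
  rewrite /= tot4 f4 //= f3 // f2 // f1 //=.
  congr (_ + _ %/ _); rewrite /closed_walks (big_nth 0) big_mkord.
  apply: eq_bigr => i _; rewrite [RHS](big_nth 0) big_mkord.
  apply: eq_bigr => j _; congr (_ * _).
  by rewrite [RHS](big_nth 0) big_mkord.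
- rewrite /= !sum_nat_const !card_ord /high_cost -/N.
  rewrite (big_nth 0) big_mkord -/N.
  have leS : \sum_(i < N) (30 + 40 * dg (H i)).+1 <= \sum_(i < N) (100 + 100 * dg (H i)).
    by apply: leq_sum => i _; lia.
  (* Work linear in the number of high vertices is absorbed by the quadratic term. *)
  have leN : N <= N * N by case: (N) => // k; rewrite leq_pmulr.
  move: leS; rewrite /H; set S1 := bigop _ _ _; set S2 := bigop _ _ _; lia.
- by [].
Qed.

(** * The total number of steps in terms of out-degrees *)

Definition low_squares :=
  \sum_(w < n) (dg w <= T) * (size (outl w) * size (outl w)).

Definition total_cost :=
  1000 * (1 + n + \sum_(x < n) dg x + low_squares + size high * size high)
  + mm (size high).

Lemma before_antisym x y : x < n -> y < n -> x != y -> ~~ before x y = before y x.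
Proof. by move=> xn yn; rewrite !before_lex //; lia. Qed.

Lemma big_outl x (F : nat -> nat) : x < n ->
  \sum_(y <- outl x) F y = \sum_(y < n) (A x y && before x y) * F y.
Proof.
move=> xn; rewrite /outl big_filter (perm_big _ (L_perm xn)) /= big_filter_cond.
rewrite big_mkcond /= sum_iota0.
by apply: eq_bigr => y _; case: (_ && _); rewrite ?mul1n.
Qed.

Lemma big_inl x (F : nat -> nat) : x < n ->
  \sum_(y <- inl x) F y = \sum_(y < n) (A y x && before y x) * F y.
Proof.
move=> xn; rewrite /inl big_filter (perm_big _ (L_perm xn)) /= big_filter_cond.
rewrite big_mkcond /= sum_iota0.
apply: eq_bigr => y _; rewrite [A y x]A_sym.
case: (boolP (A x y)) => //= Axy.
rewrite before_antisym //; first by case: (before y x); rewrite ?mul1n.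
by apply: contraTneq Axy => ->; rewrite A_irr.
Qed.

(** A later vertex has at least the same degree. This links out-degrees to the count that PLB
    neighborhoods bound. *)
Lemma size_outl_le x : x < n ->
  size (outl x) <= count (fun y => A x y && (dg x <= dg y)) (iota 0 n).
Proof.
move=> xn; rewrite size_filter (permP (L_perm xn)) count_filter.
apply: sub_count => y /= /andP[bxy Axy]; rewrite Axy /=.
by move: bxy; rewrite before_lex ?(A_lt Axy) //; lia.
Qed.

(** Exchanging the summations charges the work to [w]: the out-list of a low [w] is scanned once for
    each arc [w -> v], which gives the square of its out-degree. The other work is linear in
    vertices and edges. *)
Lemma low_cost_le : \sum_(v < n) low_cost v <=
  50 * n + 70 * (\sum_(x < n) dg x) + 30 * low_squares.
Proof.
pose c v := \sum_(w < n) (A w v && before w v) * ((dg w <= T) * size (outl w)).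
have low_cost_v v : v < n -> low_cost v <= 50 + 70 * dg v + 30 * c v.
  move=> vn; rewrite /low_cost.
  have le_out : size (outl v) <= dg v.
    by rewrite -size_L // size_filter count_size.
  have le_in : size (inl v) <= dg v.
    by rewrite -size_L // size_filter count_size.
  have -> : \sum_(w <- inl v) (30 + (dg w <= T) * (30 * size (outl w))) =
      30 * size (inl v) + 30 * c v.
    rewrite big_split /c big_distrr; congr (_ + _).
      by rewrite big_const_seq iter_addn_0 count_predT.
    by rewrite big_inl //; apply: eq_bigr => w _ /=; lia.
  lia.
have sum_lin a b d (f g : nat -> nat) :
    \sum_(v < n) (a + b * f v + d * g v) =
    a * n + b * (\sum_(v < n) f v) + d * (\sum_(v < n) g v).
  by rewrite !big_split -!big_distrr sum_nat_const card_ord /= (mulnC a).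
apply: (@leq_trans (\sum_(v < n) (50 + 70 * dg v + 30 * c v))).
  by apply: leq_sum => v _; exact: low_cost_v.
rewrite sum_lin leq_add2l leq_mul2l /= /c exchange_big.
apply: leq_sum => w _; rewrite -big_distrl /= mulnCA.
rewrite leq_mul2l; apply/orP; right; rewrite leq_mul2r; apply/orP; right.
by rewrite -sum1_size big_outl //; apply: leq_sum => v _; rewrite muln1.
Qed.

Lemma CountTrianglesFMM_spec s :
  reg s nv = n -> reg s thr = T ->
  (forall x, x < n -> stores s ADJ DEG x (L x)) ->
  ensures mm CountTrianglesFMM s total_cost
   (fun s' => reg s' cnt = \sum_(v < n) low_count v + closed_walks %/ 6).
Proof.
move=> snv sthr sadj.
have sdeg x : x < n -> cell s DEG x 0 = dg x.
  by move=> xn; case: (sadj x xn) => -> _; rewrite size_L.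
eapply ensures_weaken.
- eapply ensures_seq; first exact: sort_by_degree_spec.
  move=> s1 pos1 [f1 g1].
  eapply ensures_seq.
    apply: orient_edges_spec => //; first by rewrite f1.
    by move=> x xn; apply: (stores_same (sadj x xn)); rewrite g1.
  move=> s2 o2 [f2 g2].
  eapply ensures_seq.
    apply: count_low_spec.
    + by rewrite f2 // f1.
    + by rewrite f2 // f1.
    + by move=> x xn; rewrite g2 // g1 // sdeg.
    + by move=> x xn; case: (o2 x xn).
    + by move=> x xn; case: (o2 x xn).
  move=> s3 c3 [f3 g3].
  apply: (@ensures_weaken _ _ _ _ _ _
    (fun s' => reg s' cnt = \sum_(v < n) low_count v + closed_walks %/ 6)
    (@count_high_spec _ _ _ _)).
  + by rewrite f3 // f2 // f1.
  + by rewrite f3 // f2 // f1.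
  + by move=> x xn; apply: (stores_same (sadj x xn)); rewrite g3 // g2 // g1.
  + exact: leqnn.
  + by move=> s4 -> _; rewrite c3.
- rewrite /= /total_cost /high_cost.
  have := low_cost_le.
  have -> : \sum_(x < n) (30 * dg x + 30) = 30 * (\sum_(x < n) dg x) + 30 * n.
    by rewrite big_split /= -big_distrr /= sum_nat_const card_ord (mulnC n).
  have : \sum_(x <- high) (100 + 100 * dg x) <= 100 * n + 100 * \sum_(x < n) dg x.
    rewrite big_filter sum_iota0.
    have -> : 100 * n = \sum_(x < n) 100 by rewrite sum_nat_const card_ord mulnC.
    rewrite big_distrr -big_split /= big_mkcond; apply: leq_sum => x _.
    by case: ifP.
  set S1 := \sum_(v < n) low_cost v; set S2 := bigop _ high _; set S3 := \sum_(x < n) dg x.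
  by set S4 := size high * size high; set S5 := mm (size high); lia.
- by [].
Qed.

(** * Triangles as triples sorted by position *)

Definition triple (w v u : nat) : bool :=
  [&& A w v, A w u, A v u, before w v & before v u].

(** That [w] comes before [u], implicit in the range [outl w], follows from the two conditions in
    [triple] by transitivity. *)
Lemma sum_low_count :
  \sum_(v < n) low_count v =
  \sum_(w < n) \sum_(v < n) \sum_(u < n) (dg w <= T) && triple w v u.
Proof.
rewrite [RHS]exchange_big; apply: eq_bigr => v _ /=.
rewrite /low_count big_mkcond big_inl //; apply: eq_bigr => w _ /=.
case: (dg w <= T) => /=; last by rewrite muln0 big1.
rewrite big_outl // big_distrr; apply: eq_bigr => u _ /=.
rewrite mem_filter mem_L // /triple mulnA !mulnb; congr nat_of_bool.
have tr : before w v -> before v u -> before w u by exact: ltn_trans.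
by move: tr; case: (A w v) (A w u) (A v u) (before w v) (before v u) (before w u)
  => [] [] [] [] [] [] //= /(_ isT isT).
Qed.

(** A triple satisfying [g] has distinct entries and is increasing in exactly one of its six orders;
    renaming the summation variables shows that all orders have the same sum. *)
Lemma sum_perm6 (g : nat -> nat -> nat -> bool) :
  (forall x y z, g x y z = g y x z) -> (forall x y z, g x y z = g x z y) ->
  (forall x y, g x x y = false) ->
  \sum_(x < n) \sum_(y < n) \sum_(z < n) g x y z =
  6 * \sum_(x < n) \sum_(y < n) \sum_(z < n)
        [&& g x y z, before x y & before y z].
Proof.
move=> g12 g23 g0.
pose h x y z : nat := [&& g x y z, before x y & before y z].
have split6 x y z : x < n -> y < n -> z < n -> (g x y z : nat) =
    h x y z + (h x z y + (h y x z + (h y z x + (h z x y + h z y x)))).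
  move=> xn yn zn; rewrite /h.
  rewrite (g23 z y x) (g12 z x y) (g23 y z x) (g12 y x z) (g23 x z y).
  case: (boolP (g x y z)) => //= gxyz.
  have nxy : x != y by apply: contraTneq gxyz => ->; rewrite g0.
  have nyz : y != z by apply: contraTneq gxyz => ->; rewrite g12 g23 g0.
  have nxz : x != z by apply: contraTneq gxyz => ->; rewrite g23 g0.
  have := before_antisym xn yn nxy; have := before_antisym yn zn nyz.
  have := before_antisym xn zn nxz; rewrite /before; lia.
(* [S] does not change when adjacent variables are swapped, and the two swaps generate all six
   permutations. *)
pose S (f : nat -> nat -> nat -> nat) :=
  \sum_(x < n) \sum_(y < n) \sum_(z < n) f x y z.
have S12 f : S (fun x y z => f y x z) = S f.
  by rewrite /S exchange_big.
have S23 f : S (fun x y z => f x z y) = S f.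
  by rewrite /S; apply: eq_bigr => x _; rewrite exchange_big.
transitivity (S h + (S (fun x y z => h x z y) + (S (fun x y z => h y x z) +
   (S (fun x y z => h y z x) + (S (fun x y z => h z x y) +
    S (fun x y z => h z y x)))))).
  rewrite /S -!big_split; apply: eq_bigr => x _; rewrite -!big_split.
  apply: eq_bigr => y _; rewrite -!big_split; apply: eq_bigr => z _.
  exact: split6.
have -> : S (fun x y z => h y z x) = S h.
  by rewrite -(S23 h) -(S12 (fun x y z => h x z y)).
have -> : S (fun x y z => h z x y) = S h.
  by rewrite -(S12 h) -(S23 (fun x y z => h y x z)).
have -> : S (fun x y z => h z y x) = S h.
  rewrite -(S12 h) -(S23 (fun x y z => h y x z)).
  by rewrite -(S12 (fun x y z => h z x y)).
by rewrite (S12 h) (S23 h) -[RHS]/(6 * S h); move: (S h) => k; lia.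
Qed.

(** Each triangle of [G_delta] carries six closed walks. Its first vertex in sorted order has the
    least degree, so if that degree exceeds [T], all three do. *)
Lemma closed_walksE :
  closed_walks = 6 *
  \sum_(w < n) \sum_(v < n) \sum_(u < n) (T < dg w) && triple w v u.
Proof.
pose g x y z := [&& T < dg x, T < dg y, T < dg z, A x y, A x z & A y z].
transitivity (\sum_(x < n) \sum_(y < n) \sum_(z < n) g x y z).
  rewrite /closed_walks big_filter sum_iota0 big_mkcond.
  apply: eq_bigr => x _; rewrite big_filter sum_iota0 [X in if _ then X else _]big_mkcond.
  case: ifP => hx; last by rewrite big1 // => y _; rewrite big1 // => z _; rewrite /g hx.
  apply: eq_bigr => y _; rewrite big_filter sum_iota0 big_mkcond.
  case: ifP => hy; last by rewrite big1 // => z _; rewrite /g hy /= andbF.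
  rewrite big_distrr; apply: eq_bigr => z _; rewrite /g hx hy /= [A z y]A_sym.
  by case: ifP => _ /=; rewrite ?muln0 // !mulnb.
rewrite sum_perm6; last first.
- by move=> x y; rewrite /g A_irr !andbF.
- move=> x y z; rewrite /g (A_sym y z).
  by case: (T < dg x) (T < dg y) (T < dg z) (A x y) (A x z) (A z y)
    => [] [] [] [] [] [].
- move=> x y z; rewrite /g (A_sym y x).
  by case: (T < dg x) (T < dg y) (T < dg z) (A x y) (A x z) (A y z)
    => [] [] [] [] [] [].
congr (6 * _); apply: eq_bigr => x _; apply: eq_bigr => y _.
apply: eq_bigr => z _; congr nat_of_bool; rewrite /g /triple.
case: (boolP (before x y)) => bxy; last by rewrite !andbF.
case: (boolP (before y z)) => byz; last by rewrite !andbF.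
move: bxy byz; rewrite !before_lex // => bxy byz; rewrite !andbT.
case: (ltnP T (dg x)) => //= hx.
have -> : T < dg y by lia.
have -> : T < dg z by lia.
by [].
Qed.

Lemma count_correct :
  \sum_(v < n) low_count v + closed_walks %/ 6 =
  \sum_(w < n) \sum_(v < n) \sum_(u < n) triple w v u.
Proof.
rewrite closed_walksE mulKn // sum_low_count -big_split.
apply: eq_bigr => w _; rewrite -big_split; apply: eq_bigr => v _.
rewrite -big_split; apply: eq_bigr => u _ /=.
by rewrite ltnNge; case: (dg w <= T); rewrite ?addn0.
Qed.
End Algorithm.

(** * Graphs on 'I_n *)

(** The machine handles plain numbers, so adjacency is extended by [false] outside the range.
    Matching on [idP] supplies the bounds from which the ordinals are built. *)
Definition nat_rel (n : nat) (e : rel 'I_n) : rel nat := fun x y =>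
  match @idP (x < n), @idP (y < n) with
  | ReflectT hx, ReflectT hy => e (Ordinal hx) (Ordinal hy)
  | _, _ => false
  end.

Section NatRel.
Variables (n : nat) (e : rel 'I_n).
Hypothesis e_graph : simple_graph e.

Lemma nat_relE (x y : 'I_n) : nat_rel e x y = e x y.
Proof.
rewrite /nat_rel; case: {-}_ / idP => [hx|/(_ (ltn_ord x))//].
case: {-}_ / idP => [hy|/(_ (ltn_ord y))//].
by congr e; apply: val_inj.
Qed.

Lemma nat_rel_lt x y : nat_rel e x y -> y < n.
Proof.
rewrite /nat_rel; case: {-}_ / idP => // hx.
by case: {-}_ / idP.
Qed.

Lemma nat_rel_sym : symmetric (nat_rel e).
Proof.
case: e_graph => se _ x y; rewrite /nat_rel.
by case: {-}_ / idP => // hx; case: {-}_ / idP => // hy.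
Qed.

Lemma nat_rel_irr : irreflexive (nat_rel e).
Proof.
case: e_graph => _ ie x; rewrite /nat_rel.
by case: {-}_ / idP.
Qed.

Lemma count_iota_ord (p : pred nat) :
  count p (iota 0 n) = #|[set x : 'I_n | p x]|.
Proof.
rewrite -val_enum_ord count_map cardsE cardE /enum_mem size_filter count_filter.
by apply: eq_count => x /=; rewrite andbT.
Qed.

Lemma dg_nat_rel (x : 'I_n) : dg n (nat_rel e) x = deg e x.
Proof.
rewrite /dg count_iota_ord /deg; apply: eq_card => y.
by rewrite !inE nat_relE.
Qed.

Local Notation tri := (triple n (nat_rel e)).
Local Notation rank := (pos n (nat_rel e)).

Lemma rank_inj (x y : 'I_n) : rank x = rank y -> x = y.
Proof.
move=> exy; apply/val_inj/eqP; apply/negPn/negP => nxy.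
have := @before_antisym n (nat_rel e) _ _ (ltn_ord x) (ltn_ord y) nxy.
by rewrite /before exy ltnn.
Qed.

Lemma tri_rank (w v u : 'I_n) :
  tri w v u = [&& e w v, e w u, e v u, rank w < rank v & rank v < rank u].
Proof. by rewrite /triple !nat_relE. Qed.

(** Positions are distinct, so three vertices can be sorted in exactly one way; sending a sorted
    triple to its vertex set is a bijection onto the triangles. *)
Lemma triangles_triples :
  triangles e = \sum_(w < n) \sum_(v < n) \sum_(u < n) tri w v u.
Proof.
have [es ei] := e_graph.
pose D := [set p : 'I_n * ('I_n * 'I_n) | tri p.1 p.2.1 p.2.2].
have -> : \sum_(w < n) \sum_(v < n) \sum_(u < n) tri w v u = #|D|.
  rewrite -sum1_card.
  transitivity (\sum_(p : 'I_n * ('I_n * 'I_n)) (tri p.1 p.2.1 p.2.2 : nat)).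
    rewrite -(pair_bigA _ (fun (w : 'I_n) (q : 'I_n * 'I_n) => tri w q.1 q.2 : nat)) /=.
    by apply: eq_bigr => w _; rewrite pair_bigA.
  rewrite [RHS]big_mkcond; apply: eq_bigr => p _ /=.
  by rewrite inE; case: (tri _ _ _).
pose f (p : 'I_n * ('I_n * 'I_n)) := [set p.1; p.2.1; p.2.2].
rewrite /triangles -(card_in_imset (f := f) (D := mem D)).
  apply: eq_card => X; rewrite inE.
  apply/andP/imsetP => [[/eqP X3 /forall_inP adjX]|]; last first.
    move=> [[w [v u]]]; rewrite [_ \in mem D]inE tri_rank /= => /and5P[wv wu vu rwv rvu] ->.
    have nwv : w != v by apply: contraTneq wv => ->; rewrite ei.
    have nwu : w != u by apply: contraTneq wu => ->; rewrite ei.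
    have nvu : v != u by apply: contraTneq vu => ->; rewrite ei.
    split; first by rewrite /f /= -finset.setUA cardsU1 cards2 !inE negb_or nwv nwu nvu.
    apply/forall_inP => a; rewrite !inE => aX; apply/forall_inP => b; rewrite !inE.
    by case/orP: aX => [/orP[]|] /eqP->; move=> /orP[/orP[]|] /eqP->;
      rewrite ?eqxx //; apply/implyP => _ //; rewrite es.
  have adj a b : a \in X -> b \in X -> a != b -> e a b.
    by move=> aX bX; move: (adjX a aX) => /forall_inP /(_ b bX) /implyP.
  have : uniq (enum X) by exact: enum_uniq.
  have : X = [set x in enum X] by apply/finset.setP => x; rewrite inE mem_enum.
  have : size (enum X) = 3 by rewrite -cardE.
  case: (enum X) => [|a [|b [|c []]]] // _ XE /=.
  rewrite !inE negb_or andbT => /andP[/andP[nab nac] nbc].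
  have mX x : (x \in X) = [|| x == a, x == b | x == c] by rewrite XE !inE.
  have eab : e a b by apply: adj; rewrite ?mX ?eqxx ?orbT.
  have eac : e a c by apply: adj; rewrite ?mX ?eqxx ?orbT.
  have ebc : e b c by apply: adj; rewrite ?mX ?eqxx ?orbT.
  have [eba eca ecb] : [/\ e b a, e c a & e c b] by rewrite !(es _ a) (es c).
  have rab : rank a != rank b by apply: contra nab => /eqP /rank_inj->.
  have rac : rank a != rank c by apply: contra nac => /eqP /rank_inj->.
  have rbc : rank b != rank c by apply: contra nbc => /eqP /rank_inj->.
  (* Treats the six possible orders of [a], [b], [c] uniformly. *)
  have sorted x y z : e x y -> e x z -> e y z -> rank x < rank y -> rank y < rank z ->
     (forall t, (t == x) || (t == y) || (t == z) = [|| t == a, t == b | t == c]) ->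
     exists2 p, p \in mem D & X = f p.
    move=> exy exz eyz rxy ryz h; exists (x, (y, z)).
      by rewrite inE tri_rank exy exz eyz rxy ryz.
    by apply/finset.setP => t; rewrite mX /f !inE h.
  case: (ltngtP (rank a) (rank b)) rab => // hab _;
  case: (ltngtP (rank a) (rank c)) rac => // hac _;
  case: (ltngtP (rank b) (rank c)) rbc => // hbc _; try lia.
  - by apply: (sorted a b c); rewrite ?eqxx // => t; do !case: eqP.
  - by apply: (sorted a c b); rewrite ?eqxx // => t; do !case: eqP.
  - by apply: (sorted c a b); rewrite ?eqxx ?orbT // => t; do !case: eqP.
  - by apply: (sorted b a c); rewrite ?eqxx ?orbT // => t; do !case: eqP.
  - by apply: (sorted b c a); rewrite ?eqxx ?orbT // => t; do !case: eqP.
  - by apply: (sorted c b a); rewrite ?eqxx ?orbT // => t; do !case: eqP.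
(* Injectivity: equal sets share their elements of least and of greatest rank, which leaves one
   choice for the middle. *)
move=> [w [v u]] [w' [v' u']]; rewrite !inE !tri_rank /= /f /=.
move=> /and5P[_ _ _ rwv rvu] /and5P[_ _ _ rwv' rvu'] /finset.setP E.
have Ew : w = w'.
  apply: rank_inj; apply/eqP; rewrite eqn_leq; apply/andP; split.
    have := E w'; rewrite !inE !eqxx /=.
    by move=> /orP[/orP[]|] /eqP->; lia.
  have := E w; rewrite !inE !eqxx /=.
  by move=> /esym /orP[/orP[]|] /eqP->; lia.
have Eu : u = u'.
  apply: rank_inj; apply/eqP; rewrite eqn_leq; apply/andP; split.
    have := E u; rewrite !inE !eqxx !orbT.
    by move=> /esym /orP[/orP[]|] /eqP->; lia.
  have := E u'; rewrite !inE !eqxx !orbT.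
  by move=> /orP[/orP[]|] /eqP->; lia.
subst w' u'; congr (_, (_, _)).
have := E v; rewrite !inE eqxx orbT /= => /esym /orP[/orP[]|] /eqP // Ev.
  by rewrite Ev ltnn in rwv.
by rewrite Ev ltnn in rvu.
Qed.
End NatRel.

(** * Correctness and cost in terms of the graph alone *)

Definition up_deg (n : nat) (e : rel 'I_n) (v : 'I_n) : nat :=
  #|[set w : 'I_n | e v w && (deg e v <= deg e w)]|.

(** A step bound from which the store and the sorted order have disappeared; only degrees, the
    threshold and [mm] remain to be estimated. *)
Definition cost_bound (mm : nat -> nat) (n : nat) (e : rel 'I_n) (T : nat) : nat :=
  let h := #|[set v : 'I_n | T < deg e v]| in
  1000 * (1 + n + \sum_(v < n) deg e v
          + \sum_(v < n | deg e v <= T) up_deg e v * up_deg e v + h * h)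
  + mm h.

Lemma CountTrianglesFMM_correct (R : realType) mm n (e : rel 'I_n) (dl : R) s :
  simple_graph e -> input_store e dl s ->
  reg (exec mm CountTrianglesFMM s).1 cnt = triangles e /\
  (exec mm CountTrianglesFMM s).2 <= cost_bound mm e (Num.truncn dl).
Proof.
move=> ge [snv sthr sadj]; set T := Num.truncn dl.
(* [L] is read off the initial store, so it follows whatever order the input gives the neighbors. *)
pose A := nat_rel e; pose L x := mkseq (cell s ADJ x) (dg n A x).
have L_perm x : x < n -> perm_eq (L x) [seq y <- iota 0 n | A x y].
  move=> xn; have [_ ] := sadj (Ordinal xn).
  rewrite /L -[x]/(val (Ordinal xn)) dg_nat_rel => /perm_trans; apply.
  rewrite -val_enum_ord filter_map.
  apply: perm_map; rewrite [X in perm_eq _ X](@eq_filter _ _ (e (Ordinal xn))) // => y.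
  exact: (nat_relE e (Ordinal xn) y).
have stL x : x < n -> stores s ADJ DEG x (L x).
  move=> xn; have [dx _] := sadj (Ordinal xn).
  by split; rewrite size_mkseq // dx -(dg_nat_rel e).
have [c k] := @CountTrianglesFMM_spec mm n A (@nat_rel_lt n e)
  (nat_rel_sym ge) (nat_rel_irr ge) L L_perm T s snv sthr stL.
split.
  rewrite c (count_correct (@nat_rel_lt n e) (nat_rel_sym ge) (nat_rel_irr ge) L_perm).
  by rewrite triangles_triples.
apply: leq_trans k _; rewrite /total_cost /cost_bound.
have -> : size (high n A T) = #|[set v : 'I_n | T < deg e v]|.
  rewrite size_filter count_iota_ord; apply: eq_card => v.
  by rewrite !inE dg_nat_rel.
rewrite leq_add2r leq_mul2l /= leq_add2r; apply: leq_add.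
  by rewrite leq_add2l; apply: leq_sum => x _; rewrite dg_nat_rel.
rewrite /low_squares [in leqRHS]big_mkcond; apply: leq_sum => w _ /=.
rewrite dg_nat_rel; case: ifP => // _; rewrite mul1n.
have le_up : size (outl n A L w) <= up_deg e w.
  apply: leq_trans (size_outl_le _ L_perm _) _ => //; first exact: nat_rel_lt.
  rewrite count_iota_ord /up_deg; apply: subset_leq_card.
  by apply/fintype.subsetP => y; rewrite !inE !dg_nat_rel /A nat_relE.
exact: leq_mul.
Qed.

(** * Dyadic sums *)

Local Open Scope ring_scope.

(** * Real powers, geometric series and power tails *)

Section RealSums.
Variable R : realType.
Implicit Types x y r q s : R.

Lemma powR_add x r s : 0 < x -> x `^ (r + s) = x `^ r * x `^ s.
Proof. by move=> x0; rewrite powRD //; apply/implyP => _; rewrite gt_eqF. Qed.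

Lemma le_powR_nonpos x y r : 0 < x -> x <= y -> r <= 0 -> y `^ r <= x `^ r.
Proof.
move=> x0 xy r0; rewrite -[r]opprK powRN [leRHS]powRN.
rewrite lef_pV2 ?posrE ?powR_gt0 //; last exact: lt_le_trans xy.
by apply: ge0_ler_powR; rewrite ?nnegrE ?oppr_ge0 // ltW // (lt_le_trans x0).
Qed.

Lemma powR_ge1 x r : 1 <= x -> 0 <= r -> 1 <= x `^ r.
Proof. by move=> x1 r0; rewrite -(powRr0 x) ler_powR. Qed.

Lemma lt_powR_gt1 x r s : 1 < x -> r < s -> x `^ r < x `^ s.
Proof.
move=> x1 rs; have x0 : 0 < x by exact: lt_trans x1.
by rewrite /powR gt_eqF // ltr_expR ltr_pM2r // ln_gt0.
Qed.

Lemma powR_natX x r (d : nat) : 0 <= x -> (x ^+ d) `^ r = (x `^ r) ^+ d.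
Proof.
move=> x0; rewrite -powR_mulrn // -powRrM mulrC powRrM powR_mulrn //.
exact: powR_ge0.
Qed.

Lemma sum_geometric q (a k : nat) : q != 1 ->
  \sum_(a <= d < a + k) q ^+ d = (q ^+ a - q ^+ (a + k)) / (1 - q).
Proof.
move=> q1; have q1' : 1 - q != 0 by rewrite subr_eq0 eq_sym.
elim: k => [|k IH]; first by rewrite addn0 big_geq // subrr mul0r.
by rewrite addnS big_nat_recr ?leq_addr //= IH exprS; field.
Qed.

Lemma sum_geometric_lt1 q (a b : nat) : 0 <= q -> q < 1 ->
  \sum_(a <= d < b) q ^+ d <= q ^+ a / (1 - q).
Proof.
move=> q0 q1; have q1' : 0 < 1 - q by rewrite subr_gt0.
have [ab|ba] := leqP a b; last first.
  by rewrite big_geq ?(ltnW ba) // divr_ge0 ?exprn_ge0 // ltW.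
rewrite -(subnKC ab) sum_geometric ?lt_eqF //.
by rewrite ler_pM2r ?invr_gt0 // lerBlDr lerDl exprn_ge0.
Qed.

Lemma sum_geometric_gt1 q (b : nat) : 1 < q ->
  \sum_(0 <= d < b) q ^+ d <= q ^+ b / (q - 1).
Proof.
move=> q1; rewrite -[b in leLHS]add0n sum_geometric ?gt_eqF // add0n expr0.
rewrite -[1 - q]opprB invrN mulrN -mulNr opprB.
by rewrite ler_pM2r ?invr_gt0 ?subr_gt0 // lerBlDr lerDl.
Qed.

(** An integral comparison for [s y^(-s-1)] on [[x, x+1]], done by hand: with [u = x / (x + 1)], the
    bounds [ln u <= u - 1] and [1 + z <= exp z] give [u^(-s) >= 1 + s / (x + 1)]. *)
Lemma powR_telescope x s : 0 < x -> 0 < s ->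
  s * (x + 1) `^ (- s - 1) <= x `^ (- s) - (x + 1) `^ (- s).
Proof.
move=> x0 s0; have x1 : 0 < x + 1 by rewrite addr_gt0.
pose u := x / (x + 1); have u0 : 0 < u by rewrite divr_gt0.
have -> : x `^ (- s) = (x + 1) `^ (- s) * u `^ (- s).
  by rewrite -powRM ?ltW // /u mulrC divfK // gt_eqF.
have lnu : ln u <= - (x + 1)^-1.
  have -> : u = 1 + (- (x + 1)^-1) by rewrite /u; field; rewrite gt_eqF.
  by apply: le_ln1Dx; rewrite ltrN2 invf_lt1 // ltrDr.
have uge : 1 + s / (x + 1) <= u `^ (- s).
  rewrite /powR gt_eqF //; apply: le_trans (expR_ge1Dx _).
  by rewrite lerD2l mulNr -mulrN ler_pM2l // lerNr.
have -> : (x + 1) `^ (- s - 1) = (x + 1) `^ (- s) / (x + 1).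
  by rewrite powR_add // powR_inv1 // ltW.
by have := ler_wpM2l (powR_ge0 (x + 1) (- s)) uge; lra.
Qed.

(** The first term is at most [k^(2 - alpha)], and the later ones telescope with [s = alpha - 2];
    these are the two parts of the constant. *)
Lemma sum_powR_tail (k n : nat) (alpha : R) : (0 < k)%N -> 2 < alpha ->
  \sum_(k <= i < n) i%:R `^ (1 - alpha)
    <= (1 + (alpha - 2)^-1) * k%:R `^ (2 - alpha).
Proof.
move=> k0 ha; have s0 : 0 < alpha - 2 by rewrite subr_gt0.
have kR : 1 <= k%:R :> R by rewrite ler1n.
have [kn|nk] := ltnP k n; last first.
  by rewrite big_geq // mulr_ge0 ?powR_ge0 // addr_ge0 // invr_ge0 ltW.
rewrite -(subnKC kn) addSn.
suff : forall j, \sum_(k <= i < (k + j).+1) i%:R `^ (1 - alpha)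
    <= k%:R `^ (1 - alpha) +
       (k%:R `^ (2 - alpha) - (k + j)%:R `^ (2 - alpha)) / (alpha - 2).
  move=> /(_ (n - k.+1)%N) /le_trans; apply; rewrite [leRHS]mulrDl mul1r lerD //.
    by apply: ler_powR => //; lra.
  by rewrite mulrC ler_pM2l ?invr_gt0 // lerBlDr lerDl powR_ge0.
elim=> [|i IHi]; first by rewrite addn0 big_nat1 subrr mul0r addr0.
rewrite addnS big_nat_recr /=; last by rewrite leqW ?leq_addr.
apply: le_trans (lerD IHi (lexx _)) _.
rewrite -addrA lerD2l -lerBrDl -mulrBl ler_pdivlMr //.
have := @powR_telescope (k + i)%:R (alpha - 2); rewrite ltr0n addn_gt0 k0.
move=> /(_ isT s0); rewrite -[(k + i).+1%:R]natr1.
have -> : - (alpha - 2) - 1 = 1 - alpha by lra.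
have -> : - (alpha - 2) = 2 - alpha by lra.
by rewrite mulrC; lra.
Qed.

End RealSums.

(** * Sums over vertices, by dyadic degree buckets *)

Section GraphSums.
Variables (R : realType) (n : nat) (e : rel 'I_n) (c1 alpha t : R).
Hypotheses (c1_gt0 : 0 < c1) (e_PLB : PLB c1 e alpha t).

Definition bucket_scale : R := c1 * n%:R * (t + 1) `^ (alpha - 1).

Lemma bucket_scale_ge0 : 0 <= bucket_scale.
Proof. by rewrite /bucket_scale !mulr_ge0 ?powR_ge0 // ltW. Qed.

(** Each of the [2^d] summands of the PLB bound is at most [2^(- alpha d)], as the shift by [t >= 0]
    only decreases it. *)
Lemma card_bucket (d : nat) :
  #|[set v : 'I_n | (2 ^ d <= deg e v < 2 ^ d.+1)%N]|%:R
    <= bucket_scale * (2 `^ (1 - alpha)) ^+ d.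
Proof.
have [a1 t0 hP] := e_PLB; apply: le_trans (hP d) _.
apply: ler_wpM2l; first exact: bucket_scale_ge0.
have p2 : 0 < (2 : R) ^+ d by rewrite exprn_gt0.
apply: (@le_trans _ _ (\sum_(2 ^ d <= i < 2 ^ d.+1) ((2 : R) ^+ d) `^ (- alpha))).
  rewrite !big_nat; apply: ler_sum => i /andP[di _].
  apply: le_powR_nonpos => //; last by lra.
  by apply: ler_wpDr => //; rewrite -natrX ler_nat.
rewrite sumr_const_nat expnS mul2n -addnn addnK -[leLHS]mulr_natl natrX.
by rewrite powR_add // powRr1 // exprMn -powR_natX.
Qed.

(** [G d] dominates [F] on bucket [d], and only buckets with [a <= d < b] occur. A vertex of degree
    zero lies in no bucket, hence the separate condition on its term. *)
Lemma dyadic_sum (p : pred 'I_n) (F : 'I_n -> R) (G : nat -> R) (a b : nat) :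
  (forall v, p v -> deg e v = 0%N -> F v <= 0) ->
  (forall v d, p v -> (2 ^ d <= deg e v < 2 ^ d.+1)%N ->
     (a <= d < b)%N /\ F v <= G d) ->
  (forall d, 0 <= G d) ->
  \sum_(v < n | p v) F v <=
    bucket_scale * \sum_(a <= d < b) G d * (2 `^ (1 - alpha)) ^+ d.
Proof.
move=> F0 FG G0.
apply: (@le_trans _ _ (\sum_(v < n) \sum_(a <= d < b)
   (2 ^ d <= deg e v < 2 ^ d.+1)%N%:R * G d)).
  rewrite big_mkcond; apply: ler_sum => v _.
  have S0 : 0 <= \sum_(a <= d < b) (2 ^ d <= deg e v < 2 ^ d.+1)%N%:R * G d.
    by apply: sumr_ge0 => d _; rewrite mulr_ge0.
  case: ifP => // pv; have [d0|dgt0] := posnP (deg e v).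
    exact: le_trans (F0 v pv d0) S0.
  have dv := trunc_log_bounds (isT : 1 < 2)%N dgt0.
  have [ab le] := FG v _ pv dv.
  rewrite (big_rem (trunc_log 2 (deg e v))) /=; last by rewrite mem_index_iota.
  move: dv => /= ->; rewrite mul1r; apply: le_trans le _; rewrite lerDl.
  by apply: sumr_ge0 => d _; rewrite mulr_ge0.
rewrite exchange_big big_distrr /=; apply: ler_sum => d _.
rewrite -mulr_suml mulrCA mulrC; apply: ler_wpM2l => //.
apply: le_trans (card_bucket d); rewrite -sum1_card natr_sum.
rewrite [leRHS]big_mkcond; apply: ler_sum => v _.
by rewrite inE; case: (_ && _).
Qed.

(** Degrees in bucket [d] are below [2^(d+1)], so the series has ratio [2^(2 - alpha)], less than 1
    because [alpha > 2]. This controls the number of edges. *)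
Lemma sum_deg_le : 2 < alpha ->
  \sum_(v < n) (deg e v)%:R <=
    bucket_scale * (2 / (1 - 2 `^ (2 - alpha))).
Proof.
move=> ha.
have q1 : 2 `^ (2 - alpha) < 1 :> R.
  by rewrite -[ltRHS](powRr0 (2 : R)) lt_powR_gt1 ?ltr1n //; lra.
apply: le_trans (@dyadic_sum predT _ (fun d => 2 * 2 ^+ d) 0 n _ _ _) _.
- by move=> v _ ->.
- move=> v d _ /andP[dl du]; split.
    apply: leq_trans (ltn_expl d (isT : 1 < 2)%N) (leq_trans dl _).
    by rewrite -[n in leqRHS]card_ord max_card.
  by rewrite -exprS -natrX ler_nat ltnW.
- by move=> d; rewrite mulr_ge0 // exprn_ge0.
apply: ler_wpM2l; first exact: bucket_scale_ge0.
have -> : \sum_(0 <= d < n) 2 * 2 ^+ d * (2 `^ (1 - alpha)) ^+ d =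
    2 * \sum_(0 <= d < n) (2 `^ (2 - alpha)) ^+ d :> R.
  rewrite mulr_sumr; apply: eq_bigr => d _; rewrite -mulrA -exprMn.
  have -> : 2 - alpha = 1 + (1 - alpha) by lra.
  by rewrite [in RHS]powR_add // powRr1.
rewrite ler_pM2l //; apply: le_trans (sum_geometric_lt1 _ _ _ q1) _ => //.
by rewrite expr0 div1r.
Qed.

(** The increasing series is dominated by the bucket [M] of the threshold, where [2^M <= dl]. The
    factor [2^(6 - 2 alpha)] comes from bounding a degree by the upper end of its bucket, the
    fraction from the geometric sum. *)
Lemma sum_low_le (dl : R) : 1 <= dl -> alpha < 7 / 3 ->
  \sum_(v < n | (deg e v <= Num.truncn dl)%N) (deg e v)%:R `^ (6 - 2 * alpha)
    <= bucket_scale * (2 `^ (6 - 2 * alpha) * (2 `^ (7 - 3 * alpha)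
        / (2 `^ (7 - 3 * alpha) - 1))) * dl `^ (7 - 3 * alpha).
Proof.
move=> dl1 ha; set T := Num.truncn dl.
have T0 : (0 < T)%N by rewrite truncn_gt0.
have q1 : 1 < 2 `^ (7 - 3 * alpha) :> R.
  by rewrite -[ltLHS](powRr0 (2 : R)) lt_powR_gt1 ?ltr1n //; lra.
set M := trunc_log 2 T.
have M2 : 2 ^+ M <= dl.
  rewrite -natrX; apply: le_trans (_ : T%:R <= _).
    by rewrite ler_nat trunc_logP.
  by rewrite truncn_le (le_trans _ dl1).
apply: le_trans (@dyadic_sum _ _
  (fun d => 2 `^ (6 - 2 * alpha) * (2 `^ (6 - 2 * alpha)) ^+ d) 0 M.+1 _ _ _) _.
(* A zero degree contributes zero because the exponent is not zero. *)
- by move=> v _ ->; rewrite powR0 // gt_eqF //; lra.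
- move=> v d dT /andP[dlo du]; split.
    by rewrite ltnS /M; apply: trunc_log_max => //; exact: leq_trans dlo dT.
  rewrite -exprS -powR_natX // -natrX.
  apply: ge0_ler_powR; rewrite ?nnegrE //; first by lra.
  by rewrite ler_nat ltnW.
- by move=> d; rewrite mulr_ge0 ?exprn_ge0 ?powR_ge0.
rewrite -[leRHS]mulrA; apply: ler_wpM2l; first exact: bucket_scale_ge0.
have -> : \sum_(0 <= d < M.+1) 2 `^ (6 - 2 * alpha) * (2 `^ (6 - 2 * alpha)) ^+ d
      * (2 `^ (1 - alpha)) ^+ d =
    2 `^ (6 - 2 * alpha) * \sum_(0 <= d < M.+1) (2 `^ (7 - 3 * alpha)) ^+ d :> R.
  rewrite mulr_sumr; apply: eq_bigr => d _; rewrite -mulrA -exprMn.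
  by rewrite -powR_add //; congr (_ * _ `^ _ ^+ _); lra.
rewrite -[leRHS]mulrA ler_pM2l ?powR_gt0 //.
apply: le_trans (sum_geometric_gt1 _ q1) _.
rewrite [leRHS]mulrAC ler_pM2r ?invr_gt0 ?subr_gt0 // exprS.
rewrite ler_pM2l ?powR_gt0 // -powR_natX //.
by apply: ge0_ler_powR; rewrite ?nnegrE ?exprn_ge0 // ?(le_trans _ dl1) //; lra.
Qed.

(** The decreasing series starts at the bucket [M] of the threshold. All that is known there is
    [2^M >= dl / 2], which costs the factor [2^(alpha - 1)]. *)
Lemma card_high_le (dl : R) : 1 <= dl -> 1 < alpha ->
  #|[set v : 'I_n | (Num.truncn dl < deg e v)%N]|%:R
    <= bucket_scale * (2 `^ (alpha - 1) / (1 - 2 `^ (1 - alpha)))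
       * dl `^ (1 - alpha).
Proof.
move=> dl1 ha; set T := Num.truncn dl.
have T0 : (0 < T)%N by rewrite truncn_gt0.
have q1 : 2 `^ (1 - alpha) < 1 :> R.
  by rewrite -[ltRHS](powRr0 (2 : R)) lt_powR_gt1 ?ltr1n //; lra.
set M := trunc_log 2 T.
have M2 : dl / 2 <= 2 ^+ M.
  rewrite ler_pdivrMr // -exprSr -natrX; apply: ltW.
  apply: lt_le_trans (truncnS_gt dl) _; rewrite ler_nat.
  by have /andP[] := trunc_log_bounds (isT : 1 < 2)%N T0.
rewrite -sum1_card natr_sum.
rewrite (eq_bigl (fun v => (T < deg e v)%N)); last by move=> v; rewrite inE.
apply: le_trans (@dyadic_sum _ _ (fun=> 1) M n _ _ _) _.
- by move=> v + dv; rewrite dv.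
- move=> v d dT /andP[dlo du]; split=> //; apply/andP; split.
    rewrite -ltnS -(ltn_exp2l _ _ (isT : 1 < 2)%N).
    by apply: leq_ltn_trans (trunc_logP (isT : 1 < 2)%N T0) _; exact: ltn_trans du.
  apply: leq_trans (ltn_expl d (isT : 1 < 2)%N) (leq_trans dlo _).
  by rewrite -[n in leqRHS]card_ord max_card.
- by [].
rewrite -[leRHS]mulrA; apply: ler_wpM2l; first exact: bucket_scale_ge0.
under eq_bigr do rewrite mul1r.
apply: le_trans (sum_geometric_lt1 _ _ _ q1) _; first exact: powR_ge0.
rewrite [leRHS]mulrAC ler_pM2r ?invr_gt0 ?subr_gt0 //.
rewrite -powR_natX //.
apply: le_trans (le_powR_nonpos _ M2 _) _; [by rewrite divr_gt0 // (lt_le_trans _ dl1)|lra|].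
rewrite powRM ?invr_ge0 // ?(le_trans _ dl1) //.
rewrite [leRHS]mulrC; apply: ler_wpM2l; rewrite ?powR_ge0 //.
by rewrite -powR_inv1 // -powRrM mulN1r opprB.
Qed.

End GraphSums.

(** * Exponents *)

Section Bounds.
Variable R : realType.
Implicit Types omega alpha t : R.

(** The bound [ln y <= y] at [y = x^(s/2)], squared. It is applied with [s] the excess over 1 of the
    exponent of [n]. *)
Lemma log2_sqr_le (x s : R) : 1 <= x -> 0 < s ->
  log2 x ^+ 2 <= (2 / (s * ln 2)) ^+ 2 * x `^ s.
Proof.
move=> x1 s0; have ln2 : 0 < ln 2 :> R by rewrite ln_gt0 // ltr1n.
have -> : x `^ s = (x `^ (s / 2)) ^+ 2.
  by rewrite -powR_mulrn ?powR_ge0 // -powRrM divfK.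
rewrite -exprMn ler_pXn2r ?nnegrE //; last first.
- by rewrite mulr_ge0 ?powR_ge0 // divr_ge0 // mulr_ge0 // ltW.
- by rewrite /log2 divr_ge0 // ?ln_ge0 // ?ler1n.
have -> : 2 / (s * ln 2) * x `^ (s / 2) = 2 / s * x `^ (s / 2) / ln 2.
  by field; rewrite !gt_eqF.
rewrite /log2 ler_pM2r ?invr_gt0 //.
rewrite [leRHS]mulrAC ler_pdivlMr // mulrC.
have h : ln (x `^ (s / 2)) <= x `^ (s / 2).
  have := @le_ln1Dx R (x `^ (s / 2) - 1).
  rewrite addrCA subrr addr0 => /(_ _) /le_trans; apply.
    by rewrite ltrBrDr addNr powR_gt0 // (lt_le_trans _ x1).
  by rewrite gerBl.
by move: h; rewrite ln_powR; lra.
Qed.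

(** The maximum is at most the sum; dropping [t] from the tail bounds it by a multiple of
    [k^(2 - alpha)]; and [(x + y)^2 <= 2 x^2 + 2 y^2] separates the two parts. *)
Lemma up_deg_sqr_le (n : nat) (e : rel 'I_n) (c2 alpha t : R) (v : 'I_n) :
  0 < c2 -> 2 < alpha -> 0 <= t -> PLB_neighborhoods c2 e alpha t ->
  (up_deg e v * up_deg e v)%N%:R <=
    2 * c2 ^+ 2 * log2 n%:R ^+ 2 +
    2 * c2 ^+ 2 * (1 + (alpha - 2)^-1) ^+ 2 * (t + 1) `^ (2 * alpha - 4)
      * (deg e v)%:R `^ (6 - 2 * alpha) :> R.
Proof.
move=> hc2 ha t0 hN.
have n1 : 1 <= n%:R :> R by rewrite ler1n (leq_ltn_trans _ (ltn_ord v)).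
have L0 : 0 <= log2 n%:R :> R.
  by rewrite /log2 divr_ge0 // ln_ge0 // ler1n.
have Y0 : 0 < t + 1 by lra.
set C3 := 1 + (alpha - 2)^-1.
have C30 : 0 <= C3 by rewrite addr_ge0 // invr_ge0; lra.
(* Degree zero is treated apart, since the tail estimate needs [k > 0]. *)
have [d0|dgt0] := posnP (deg e v).
  have -> : up_deg e v = 0%N.
    apply/eqP; rewrite -leqn0 -[leqRHS]d0; apply: subset_leq_card.
    by apply/fintype.subsetP => w; rewrite !inE => /andP[].
  have c22 : 0 <= 2 * c2 ^+ 2 by apply: mulr_ge0; rewrite ?sqr_ge0.
  exact: (addr_ge0 (mulr_ge0 c22 (sqr_ge0 _))
    (mulr_ge0 (mulr_ge0 (mulr_ge0 c22 (sqr_ge0 _)) (powR_ge0 _ _)) (powR_ge0 _ _))).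
set k := deg e v in dgt0 *.
have k0 : 0 < k%:R :> R by rewrite ltr0n.
pose M : R := C3 * ((t + 1) `^ (alpha - 2) * k%:R `^ (3 - alpha)).
have M0 : 0 <= M by rewrite !mulr_ge0 ?powR_ge0.
have M2 : M ^+ 2 = C3 ^+ 2 * (t + 1) `^ (2 * alpha - 4) * k%:R `^ (6 - 2 * alpha).
  rewrite /M !exprMn -(powR_mulrn 2 (powR_ge0 (t + 1) _)).
  rewrite -(powR_mulrn 2 (powR_ge0 k%:R _)) -!powRrM mulrA.
  by congr (_ * _ `^ _ * _ `^ _); lra.
have leu : (up_deg e v)%:R <= c2 * (log2 n%:R + M).
  apply: le_trans (hN v) _; rewrite ler_pM2l // ge_max; apply/andP; split.
    by rewrite lerDl.
  apply: ler_wpDl => //.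
  have -> : M = (t + 1) `^ (alpha - 2) * k%:R * (C3 * k%:R `^ (2 - alpha)).
    rewrite /M; have -> : 3 - alpha = 1 + (2 - alpha) by lra.
    by rewrite (@powR_add _ _ 1 _ k0) powRr1 ?ltW //; ring.
  rewrite ler_pM2l ?mulr_gt0 ?powR_gt0 //.
  apply: le_trans (sum_powR_tail n dgt0 ha).
  rewrite !big_nat; apply: ler_sum => i /andP[ki _].
  have i0 : 0 < i%:R :> R by rewrite ltr0n (leq_trans dgt0).
  rewrite (@powR_add _ _ 1 _ i0) (powRr1 (ltW i0)) ler_pM2l //.
  by apply: le_powR_nonpos => //; lra.
rewrite natrM -expr2.
have u0 : 0 <= (up_deg e v)%:R :> R by [].
apply: (@le_trans _ _ ((c2 * (log2 n%:R + M)) ^+ 2)).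
  by rewrite ler_pXn2r ?nnegrE // mulr_ge0 ?addr_ge0 // ltW.
have -> : 2 * c2 ^+ 2 * C3 ^+ 2 * (t + 1) `^ (2 * alpha - 4) * k%:R `^ (6 - 2 * alpha)
  = 2 * c2 ^+ 2 * M ^+ 2 by rewrite M2; ring.
rewrite exprMn; have : 0 <= c2 ^+ 2 * (log2 n%:R - M) ^+ 2.
  by rewrite mulr_ge0 ?sqr_ge0.
by set l := log2 _; lra.
Qed.

(** * Exponents of the threshold and of the running time *)

(** [expden - 2 = (omega - 2)(alpha - 1) + (3 - alpha)]. It makes both exponents in [delta]
    nonnegative, whence [delta >= 1]. *)
Lemma expden_gt2 omega alpha : 2 <= omega -> 2 < alpha -> alpha < 7 / 3 ->
  2 < expden omega alpha.
Proof.
move=> ho ha hb; rewrite /expden.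
have : 0 <= (omega - 2) * (alpha - 1) by rewrite mulr_ge0 //; lra.
lra.
Qed.

(** Numerator minus denominator is [(7 - 3 alpha)(omega - 1)]. The strict excess over 1 leaves room
    for the logarithms. *)
Lemma time_exp_n_gt1 omega alpha : 2 <= omega -> 2 < alpha -> alpha < 7 / 3 ->
  1 < time_exp_n omega alpha.
Proof.
move=> ho ha hb; have D2 := expden_gt2 ho ha hb.
rewrite /time_exp_n ltr_pdivlMr; last by lra.
rewrite mul1r /expden.
have : 0 < (7 - 3 * alpha) * (omega - 1) by rewrite mulr_gt0 //; lra.
lra.
Qed.

(** [2 omega - expden = (omega - 2)(3 - alpha) + (alpha - 1)]. Together with the bound on the
    exponent of [n], it puts [n (t+1)^(alpha-1)], the order of the degree sum, below the final
    bound. *)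
Lemma time_exp_t_ge omega alpha : 2 <= omega -> 2 < alpha -> alpha < 7 / 3 ->
  alpha - 1 <= time_exp_t omega alpha.
Proof.
move=> ho ha hb; have D2 := expden_gt2 ho ha hb.
rewrite /time_exp_t ler_pdivlMr; last by lra.
rewrite mulrC ler_pM2r; last by lra.
rewrite /expden.
have : 0 <= (omega - 2) * (3 - alpha) by rewrite mulr_ge0 //; lra.
lra.
Qed.

Lemma delta_ge1 omega alpha t (n : nat) :
  2 <= omega -> 2 < alpha -> alpha < 7 / 3 -> (0 < n)%N -> 0 <= t ->
  1 <= delta omega alpha n t.
Proof.
move=> ho ha hb n0 t0; have D2 := expden_gt2 ho ha hb.
rewrite /delta -[leLHS]mulr1; apply: ler_pM => //; apply: powR_ge1.
- by rewrite ler1n.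
- by apply: divr_ge0; lra.
- by lra.
- by rewrite subr_ge0 ler_pdivrMr; lra.
Qed.

(* [delta] is chosen to balance the two phases: the squared out-degrees of the
   low vertices and the matrix product on the high ones cost the same. *)
Lemma delta_low omega alpha t (n : nat) :
  2 <= omega -> 2 < alpha -> alpha < 7 / 3 -> (0 < n)%N -> 0 <= t ->
  (t + 1) `^ (2 * alpha - 4) * (n%:R * (t + 1) `^ (alpha - 1))
    * delta omega alpha n t `^ (7 - 3 * alpha)
  = n%:R `^ time_exp_n omega alpha * (t + 1) `^ time_exp_t omega alpha.
Proof.
move=> ho ha hb n0 t0; have D2 := expden_gt2 ho ha hb.
have X0 : 0 < n%:R :> R by rewrite ltr0n.
have Y0 : 0 < t + 1 by lra.
rewrite /delta powRM ?powR_ge0 // -!powRrM.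
have -> : time_exp_n omega alpha =
    1 + (omega - 1) / expden omega alpha * (7 - 3 * alpha).
  by rewrite /time_exp_n; move: D2; rewrite /expden => D2; field; lra.
have -> : time_exp_t omega alpha = (2 * alpha - 4) + ((alpha - 1) +
    (1 - 2 / expden omega alpha) * (7 - 3 * alpha)).
  by rewrite /time_exp_t; move: D2; rewrite /expden => D2; field; lra.
by rewrite !powR_add // powRr1 ?ltW //; ring.
Qed.

(** With [W] the final bound, the number of high vertices has order at most [W^(1/omega)], so their
    matrix product costs order [W]. *)
Lemma delta_high omega alpha t (n : nat) :
  2 <= omega -> 2 < alpha -> alpha < 7 / 3 -> (0 < n)%N -> 0 <= t ->
  n%:R * (t + 1) `^ (alpha - 1) * delta omega alpha n t `^ (1 - alpha)
  = (n%:R `^ time_exp_n omega alpha * (t + 1) `^ time_exp_t omega alpha)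
      `^ (omega^-1).
Proof.
move=> ho ha hb n0 t0; have D2 := expden_gt2 ho ha hb.
have X0 : 0 < n%:R :> R by rewrite ltr0n.
have Y0 : 0 < t + 1 by lra.
rewrite /delta !powRM ?powR_ge0 // -!powRrM.
have -> : time_exp_n omega alpha / omega =
    1 + (omega - 1) / expden omega alpha * (1 - alpha).
  by rewrite /time_exp_n; move: D2; rewrite /expden => D2; field; lra.
have -> : time_exp_t omega alpha / omega = (alpha - 1) +
    (1 - 2 / expden omega alpha) * (1 - alpha).
  by rewrite /time_exp_t; move: D2; rewrite /expden => D2; field; lra.
by rewrite !powR_add // powRr1 ?ltW //; ring.
Qed.

(** The decimal coefficients are rounded, hence closeness instead of equality. Clearing the positive
    denominators leaves polynomial inequalities in [alpha] between 2 and 7/3. *)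
Lemma time_exponents_238 alpha : 2 < alpha -> alpha < 7 / 3 ->
  `|time_exp_n (238 / 100) alpha
       - (2304 / 100 - 768 / 100 * alpha) / (746 / 100 - alpha)| <= 1 / 100 /\
  `|time_exp_t (238 / 100) alpha
       - 767 / 100 * (alpha - 1) / (746 / 100 - alpha)| <= 1 / 100.
Proof.
move=> ha hb; rewrite /time_exp_n /time_exp_t /expden.
set D := 7 - _ + _; set E := 746 / 100 - alpha.
have D0 : 0 < D by rewrite /D; lra.
have E0 : 0 < E by rewrite /E; lra.
have key (a b : R) : `|a * E - b * D| <= D * E / 100 ->
    `|a / D - b / E| <= 1 / 100.
  have -> : a / D - b / E = (a * E - b * D) / (D * E).
    by field; rewrite !gt_eqF.
  rewrite normrM [`|(D * E)^-1|]gtr0_norm ?invr_gt0 ?mulr_gt0 //.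
  by rewrite ler_pdivrMr ?mulr_gt0 // => /le_trans; apply; lra.
by split; apply: key; rewrite ler_norml /D /E; apply/andP; split; nra.
Qed.

End Bounds.

(** * Combination of the estimates *)

Lemma cost_bound_le (R : realType) (omega K : R) (mm : nat -> nat)
    (homega : 2 <= omega)
    (hmm : forall m : nat, (0 < m)%N -> (mm m)%:R <= K * m%:R `^ omega)
    (c1 c2 alpha : R) (hc1 : 0 < c1) (hc2 : 0 < c2)
    (halpha : 2 < alpha) (halpha' : alpha < 7 / 3) :
  exists C : R, forall (n : nat) (e : rel 'I_n) (t : R),
    (0 < n)%N -> PLB c1 e alpha t -> PLB_neighborhoods c2 e alpha t ->
    (cost_bound mm e (Num.truncn (delta omega alpha n t)))%:R
      <= C * n%:R `^ time_exp_n omega alpha * (t + 1) `^ time_exp_t omega alpha.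
Proof.
set a := time_exp_n omega alpha; set b := time_exp_t omega alpha.
have a1 : 1 < a by exact: time_exp_n_gt1.
have b1 : alpha - 1 <= b by exact: time_exp_t_ge.
have K0 : 0 <= K by have := hmm 1%N isT; rewrite powR1 mulr1; apply: le_trans.
have w0 : 0 < omega by lra.
pose K1 : R := c1 * (2 / (1 - 2 `^ (2 - alpha))).
pose K2 : R := c1 * (2 `^ (6 - 2 * alpha) * (2 `^ (7 - 3 * alpha)
        / (2 `^ (7 - 3 * alpha) - 1))).
pose K3 : R := c1 * (2 `^ (alpha - 1) / (1 - 2 `^ (1 - alpha))).
pose A1 : R := 2 * c2 ^+ 2 * (2 / ((a - 1) * ln 2)) ^+ 2.
pose A2 : R := 2 * c2 ^+ 2 * (1 + (alpha - 2)^-1) ^+ 2.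
have A20 : 0 <= A2 by rewrite /A2; apply: mulr_ge0; rewrite ?sqr_ge0 // mulr_ge0 ?sqr_ge0.
have K10 : 0 <= K1.
  rewrite /K1 mulr_ge0 ?divr_ge0 ?(ltW hc1) // subr_ge0 ltW //.
  by rewrite -[ltRHS](powRr0 (2 : R)) lt_powR_gt1 ?ltr1n //; lra.
have K30 : 0 <= K3.
  rewrite /K3 mulr_ge0 ?divr_ge0 ?(ltW hc1) ?powR_ge0 // subr_ge0 ltW //.
  by rewrite -[ltRHS](powRr0 (2 : R)) lt_powR_gt1 ?ltr1n //; lra.
exists (1000 * (2 + K1 + (A1 + A2 * K2) + K3 ^+ 2)
        + ((mm 0)%:R + K * K3 `^ omega)) => n e t n0 hP hN.
have [_ t0 _] := hP.
have X1 : 1 <= n%:R :> R by rewrite ler1n.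
have X0 : 0 < n%:R :> R by rewrite ltr0n.
have Y1 : 1 <= t + 1 by lra.
have Y0 : 0 < t + 1 by lra.
rewrite -mulrA; set W := n%:R `^ a * (t + 1) `^ b.
have dl1 : 1 <= delta omega alpha n t by exact: delta_ge1.
have XaW : n%:R `^ a <= W by rewrite ler_peMr ?powR_ge0 // powR_ge1 //; lra.
have XW : n%:R <= W.
  by apply: le_trans XaW; rewrite -[leLHS]powRr1 ?ler0n // ler_powR // ltW.
have W1 : 1 <= W by exact: le_trans X1 XW.
have XYW : n%:R * (t + 1) `^ (alpha - 1) <= W.
  apply: ler_pM; rewrite ?powR_ge0 ?ler0n //; last by rewrite ler_powR.
  by rewrite -[leLHS]powRr1 ?ler0n // ler_powR // ltW.
set dl := delta omega alpha n t in dl1 *; set T := Num.truncn dl.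
(* [Z] is the order of the number of high vertices; [omega >= 2] gives [Z^2 <= W], so handling the
   matrix entries fits the bound. *)
pose Z := W `^ omega^-1.
have Z1 : 1 <= Z by rewrite powR_ge1 // invr_ge0 ltW.
have W0 : 0 <= W by exact: le_trans W1.
have Z0 : 0 <= Z by exact: le_trans Z1.
have ZW : Z `^ omega = W.
  by rewrite /Z -powRrM mulVf ?gt_eqF // powRr1.
have Z2W : Z ^+ 2 <= W.
  by rewrite -ZW -powR_mulrn // ler_powR.
have EH : n%:R * (t + 1) `^ (alpha - 1) * dl `^ (1 - alpha) = Z.
  exact: delta_high.
have EL : (t + 1) `^ (2 * alpha - 4) * (n%:R * (t + 1) `^ (alpha - 1))
    * dl `^ (7 - 3 * alpha) = W by exact: delta_low.
have regroup p q r s u : p * q * r * s * u = p * s * (q * r * u) :> R by ring.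
rewrite /cost_bound; set h := #|_|; set S := (\sum_(v < n) deg e v)%N.
set Lo := (\sum_(v < n | _) _)%N.
have hS : S%:R <= K1 * W.
  rewrite natr_sum; apply: le_trans (sum_deg_le hc1 hP halpha) _.
  by have := ler_wpM2l K10 XYW; rewrite /K1 /bucket_scale; lra.
have hh : h%:R <= K3 * Z.
  apply: le_trans (card_high_le hc1 hP dl1 _) _; first by lra.
  by rewrite /bucket_scale regroup EH.
have hh2 : h%:R ^+ 2 <= K3 ^+ 2 * W.
  apply: (@le_trans _ _ ((K3 * Z) ^+ 2)).
    by rewrite ler_pXn2r ?nnegrE ?ler0n // mulr_ge0.
  by rewrite exprMn ler_wpM2l ?sqr_ge0.
have hm : (mm h)%:R <= ((mm 0)%:R + K * K3 `^ omega) * W.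
  have [->|h0] := posnP h.
    rewrite mulrDl; apply: ler_wpDr; last by rewrite ler_peMr.
    by rewrite mulr_ge0 // mulr_ge0 ?powR_ge0.
  rewrite mulrDl; apply: ler_wpDl; first by rewrite mulr_ge0.
  apply: le_trans (hmm h h0) _; rewrite -mulrA; apply: ler_wpM2l => //.
  have -> : K3 `^ omega * W = (K3 * Z) `^ omega by rewrite (powRM _ K30 Z0) ZW.
  by apply: ge0_ler_powR; rewrite ?nnegrE ?ler0n ?(ltW w0) // mulr_ge0.
have hLo : Lo%:R <= (A1 + A2 * K2) * W.
  rewrite natr_sum.
  apply: (@le_trans _ _ (\sum_(v < n | (deg e v <= T)%N)
     (2 * c2 ^+ 2 * log2 n%:R ^+ 2 + A2 * (t + 1) `^ (2 * alpha - 4) *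
        (deg e v)%:R `^ (6 - 2 * alpha)))).
    by apply: ler_sum => v _; exact: up_deg_sqr_le hc2 halpha t0 hN.
  rewrite big_split [leRHS]mulrDl /=; apply: lerD.
    rewrite sumr_const -[leLHS]mulr_natr.
    apply: (@le_trans _ _ (2 * c2 ^+ 2 * log2 n%:R ^+ 2 * n%:R)).
      apply: ler_wpM2l; first by apply: mulr_ge0; rewrite ?sqr_ge0 // mulr_ge0 ?sqr_ge0.
      by rewrite ler_nat -[leqRHS]card_ord max_card.
    (* The factor [(log n)^2] is absorbed into [n^(a - 1)], at the price of the constant [A1]. *)
    apply: (@le_trans _ _ (A1 * n%:R `^ a)); last first.
      apply: ler_wpM2l XaW; rewrite /A1; apply: mulr_ge0; rewrite ?sqr_ge0 //.
      by rewrite mulr_ge0 ?sqr_ge0.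
    have -> : n%:R `^ a = n%:R `^ (a - 1) * n%:R :> R.
      rewrite -{3}[n%:R](powRr1 (ltW X0)) -powR_add //; congr powR; lra.
    rewrite mulrA ler_pM2r // /A1 -[leRHS]mulrA; apply: ler_wpM2l.
      by rewrite mulr_ge0 ?sqr_ge0.
    by apply: log2_sqr_le => //; lra.
  rewrite -mulr_sumr -[leLHS]mulrA -[leRHS]mulrA; apply: ler_wpM2l => //.
  apply: le_trans (ler_wpM2l (powR_ge0 _ _) (sum_low_le hc1 hP dl1 halpha')) _.
  by rewrite /bucket_scale regroup mulrCA [X in _ * X]mulrA EL.
rewrite natrD natrM !natrD natrM -expr2 [leRHS]mulrDl; apply: lerD; last exact: hm.
rewrite -[leRHS]mulrA; apply: ler_wpM2l; first exact: ler0n.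
rewrite [leRHS]mulrDl; apply: lerD; last exact: hh2.
rewrite [leRHS]mulrDl; apply: lerD; last exact: hLo.
rewrite [leRHS]mulrDl; apply: lerD; last exact: hS.
by move: XW W1; clearbody W; lra.
Qed.

(* [mm m] is the time to multiply two m x m matrices.  The second half of the
   conclusion evaluates the exponents numerically at omega = 2.38. *)
Theorem theorem5p7 (R : realType) (omega K : R) (mm : nat -> nat)
    (homega : 2 <= omega)
    (hmm : forall m : nat, (0 < m)%N -> (mm m)%:R <= K * m%:R `^ omega)
    (c1 c2 alpha : R) (hc1 : 0 < c1) (hc2 : 0 < c2)
    (halpha : 2 < alpha) (halpha' : alpha < 7 / 3) :
  (exists C : R,
   forall (n : nat) (e : rel 'I_n) (t : R) (s : store),
     (0 < n)%N -> simple_graph e ->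
     PLB c1 e alpha t -> PLB_neighborhoods c2 e alpha t ->
     input_store e (delta omega alpha n t) s ->
     reg (exec mm CountTrianglesFMM s).1 cnt = triangles e /\
     (exec mm CountTrianglesFMM s).2%:R
       <= C * n%:R `^ time_exp_n omega alpha
            * (t + 1) `^ time_exp_t omega alpha)
  /\
  (`|time_exp_n (238 / 100) alpha
       - (2304 / 100 - 768 / 100 * alpha) / (746 / 100 - alpha)| <= 1 / 100 /\
   `|time_exp_t (238 / 100) alpha
       - 767 / 100 * (alpha - 1) / (746 / 100 - alpha)| <= 1 / 100).
Proof.
split; last exact: time_exponents_238.
have [C hC] := cost_bound_le homega hmm hc1 hc2 halpha halpha'.
exists C => n e t s n0 ge hP hN hs.
have [correct cost] := CountTrianglesFMM_correct mm ge hs.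
split=> //; apply: le_trans (hC n e t n0 hP hN).
by rewrite ler_nat.
Qed.
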